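(* Let $n\ge1$ and $f(u)=|u|^{4/n}u\,e^{u^2}$. There exist positive constants $\varepsilon=\varepsilon(n)$, $C=C(n)$ and a positive function $F=F(n,p_*,\|\varphi\|_{L^{p_*}})$ such that the following holds. Let $\varphi\in\exp L^2$ with $\varphi\ge0$, assume that there exists a unique positive solution $u$ of the Cauchy problem $\partial_tu=\Delta u+f(u)$, $u(0)=\varphi$, satisfying $\sup_{t>0}\|u(t)\|_{\exp L^2}\le2\|\varphi\|_{\exp L^2}$, and assume furthermore that $\varphi\in L^p$ for some $p\in[1,2)$. Put $p_*:=\max\{p,\frac{2n}{n+4}\}$. If $$\|\varphi\|_{\exp L^2}<\min\left(\varepsilon,F(n,p_*,\|\varphi\|_{L^{p_*}})\right),$$ then for all $q\in[p_*,\infty]$, $$\|u(t)\|_{L^q}\le C\,t^{-\frac n2\left(\frac1{p_*}-\frac1q\right)}\|\varphi\|_{\exp L^2\cap L^{p_*}},\qquad t>0.$$ In particular, if $p\in(p_1,2)$, where $p_1:=\max\{1,\frac{2n}{n+4}\}$, then for all $q\in[p_*,\infty]$, $$\|u(t)\|_{L^q}=o\left(t^{-\frac n2\left(\frac1{p_*}-\frac1q\right)}\right),\qquad t\to\infty.$$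
   Context: Orlicz space: $\exp L^2=\exp L^2(\mathbb{R}^n)$ is the space of $u\in L^1_{loc}(\mathbb{R}^n)$ such that $\int_{\mathbb{R}^n}(\exp((|u(x)|/\lambda)^2)-1)\,dx<\infty$ for some $\lambda>0$, with the Luxemburg norm $\|u\|_{\exp L^2}=\inf\{\lambda>0:\int_{\mathbb{R}^n}(\exp((|u(x)|/\lambda)^2)-1)\,dx\le1\}$. The norm of the intersection is $\|\varphi\|_{\exp L^2\cap L^{p}}=\|\varphi\|_{\exp L^2}+\|\varphi\|_{L^{p}}$. Weak$^*$ convergence: the predual of $\exp L^2$ is the Orlicz space of the complementary function $\tilde A(t)=\sup_{s\ge0}(ts-A(s))$ of $A(s)=e^{s^2}-1$. ''$u(t)\to\varphi$ in the weak$^*$ topology as $t\to0$'' means $\lim_{t\to0}\int_{\mathbb{R}^n}(u(t,x)-\varphi(x))\psi(x)\,dx=0$ for every $\psi$ in this predual. Heat semigroup: $e^{t\Delta}\varphi=G_2(t,\cdot)*\varphi$ with $G_2(t,x)=(4\pi t)^{-n/2}e^{-|x|^2/(4t)}$. Solution: ''solution'' means mild solution in $(0,\infty)\times\mathbb{R}^n$: $u\in L^\infty(0,\infty;\exp L^2)\cap C((0,\infty);\exp L^2)$, $u(t)=e^{t\Delta}\varphi+\int_0^te^{(t-s)\Delta}f(u(s))\,ds$ for $t>0$, and $u(t)\to\varphi$ in the weak$^*$ topology as $t\to0$. $L^q=L^q(\mathbb{R}^n)$. *)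

(* Defs.v *)
From HB Require Import structures.
From mathcomp Require Import all_boot all_order all_algebra.
From mathcomp Require Import all_classical all_reals all_analysis.
Set Implicit Arguments.
Unset Strict Implicit.
Unset Printing Implicit Defensive.
Import Order.TTheory GRing.Theory Num.Theory.
Import numFieldNormedType.Exports.
Local Open Scope classical_set_scope.
Local Open Scope ring_scope.

(* R^n, with the product sigma-algebra of the Borel sigma-algebra of R. *)
Notation Rn R n := (n.-tuple (measurableTypeR R)).

Section LebesgueMeasureRn.
Variable R : realType.
Local Open Scope ereal_scope.

Definition consRn n (z : measurableTypeR R * Rn R n) : Rn R n.+1 :=
  [tuple of z.1 :: z.2].

Lemma measurable_consRn n : measurable_fun setT (@consRn n).
Proof. by apply: measurable_cons; [exact: measurable_fst|exact: measurable_snd]. Qed.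

Section succ.
Variables (n : nat) (m : {sigma_finite_measure set (Rn R n) -> \bar R}).

Definition lebesgueRnS : set (Rn R n.+1) -> \bar R :=
  pushforward (lebesgue_measure \x m) (@consRn n).

Let lebesgueRnS0 : lebesgueRnS set0 = 0.
Proof. by rewrite /lebesgueRnS /pushforward preimage_set0 measure0. Qed.

Let lebesgueRnS_ge0 A : 0 <= lebesgueRnS A.
Proof. exact: integral_ge0. Qed.

Let lebesgueRnS_sigma_additive : semi_sigma_additive lebesgueRnS.
Proof.
move=> F mF tF mUF; rewrite /lebesgueRnS /pushforward preimage_bigcup.
have mc := @measurable_consRn n.
apply: measure_semi_sigma_additive.
- by move=> k; rewrite -[X in measurable X]setTI; exact: mc.
- apply/trivIsetP => /= i j _ _ ij; rewrite -preimage_setI.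
  by move/trivIsetP : tF => /(_ _ _ _ _ ij) ->//; rewrite preimage_set0.
- by rewrite -preimage_bigcup -[X in measurable X]setTI; exact: mc.
Qed.

HB.instance Definition _ := isMeasure.Build _ _ _ lebesgueRnS
  lebesgueRnS0 lebesgueRnS_ge0 lebesgueRnS_sigma_additive.

Let lebesgueRnS_sigma_finite : sigma_finite setT lebesgueRnS.
Proof.
have /sigma_finiteP[F [TF ndF Foo]] := sigma_finiteT (@lebesgue_measure R).
have /sigma_finiteP[G [TG ndG Goo]] := sigma_finiteT m.
pose g (x : Rn R n.+1) : measurableTypeR R * Rn R n :=
  (thead x, [tuple of behead x]).
have mg : measurable_fun setT g.
  by apply: measurable_fun_pair; [exact: measurable_tnth|exact: measurable_behead].
exists (fun k => g @^-1` (F k `*` G k)).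
  rewrite -preimage_bigcup -[LHS](preimage_setT g) -setXTT TF TG; congr (_ @^-1` _).
  apply/seteqP; split => [[x y] [/= [i _ Fx] [k _ Gy]]|[x y] [k _ [/= Fx Gy]]].
    exists (maxn i k) => //; split.
    - by move: x Fx; exact/subsetPset/ndF/leq_maxl.
    - by move: y Gy; exact/subsetPset/ndG/leq_maxr.
  by split; exists k.
move=> k; have [? ?] := Foo k; have [? ?] := Goo k; split.
  by rewrite -[X in measurable X]setTI; apply: mg => //; exact: measurableX.
rewrite /lebesgueRnS /pushforward -comp_preimage (_ : g \o _ = id).
  by rewrite product_measure1E// lte_mul_pinfty// ge0_fin_numE.
apply/funext => -[a b]; rewrite /g /consRn/= theadE; congr (_, _).
exact/val_inj.
Qed.

HB.instance Definition _ := Measure_isSigmaFinite.Build _ _ _ lebesgueRnS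
  lebesgueRnS_sigma_finite.

End succ.

Fixpoint lebesgueRn n : {sigma_finite_measure set (Rn R n) -> \bar R} :=
  match n with
  | 0%N => \d_([tuple] : Rn R 0)
  | k.+1 => lebesgueRnS (lebesgueRn k)
  end.

Lemma lebesgueRn_box n (A : 'I_n -> set (measurableTypeR R)) :
  (forall i, measurable (A i)) ->
  lebesgueRn n [set x | forall i, A i (tnth x i)] =
  \prod_(i < n) lebesgue_measure (A i).
Proof.
elim: n A => [|n IHn] A mA.
  by rewrite big_ord0 /= diracE mem_set// => -[].
have mB : measurable [set x : Rn R n | forall i, A (lift ord0 i) (tnth x i)].
  rewrite (_ : [set x | _] = \bigcap_(i in [set: 'I_n])
      (@tnth n (measurableTypeR R) ^~ i) @^-1` A (lift ord0 i)).
    apply: fin_bigcap_measurable; first exact: finite_finset.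
    by move=> i _; rewrite -[X in measurable X]setTI; exact: measurable_tnth.
  by apply/seteqP; split => x /= H i => [_|]; exact: H.
rewrite big_ord_recl /= /lebesgueRnS /pushforward.
rewrite (_ : _ @^-1` _ =
    A ord0 `*` [set x | forall i, A (lift ord0 i) (tnth x i)]); last first.
  apply/seteqP; split => [[a b] /= H|[a b] /= [Ha Hb] i].
    split; first by have := H ord0.
    by move=> i; have := H (lift ord0 i); rewrite /consRn /= tnthS.
  case: (unliftP ord0 i) => [j ->|->] //.
  by rewrite /consRn /= tnthS.
by rewrite product_measure1E//= (IHn (fun i => A (lift ord0 i))).
Qed.

End LebesgueMeasureRn.

Definition subRn (R : realType) n (x y : Rn R n) : Rn R n :=
  [tuple tnth x i - tnth y i | i < n].

Definition normRn (R : realType) n (x : Rn R n) : R :=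
  Num.sqrt (\sum_(i < n) tnth x i ^+ 2).

Section OrliczSpaces.
Variables (R : realType) (n : nat).
Implicit Types (A : R -> \bar R) (u : Rn R n -> R).
Local Open Scope ereal_scope.

Definition L1loc u := forall r : R,
  (lebesgueRn R n).-integrable [set x | (normRn x <= r)%R] (EFin \o u).

Definition orlicz_modular A u (l : R) : \bar R :=
  \int[lebesgueRn R n]_x A (`|u x| / l)%R.

Definition orlicz A u : Prop :=
  [/\ measurable_fun setT u, L1loc u &
      exists2 l : R, (0 < l)%R & orlicz_modular A u l < +oo].

(* The Luxemburg norm, with value +oo outside the Orlicz space. *)
Definition luxemburg A u : \bar R :=
  ereal_inf [set l%:E | l in
    [set l : R | (0 < l)%R /\ orlicz_modular A u l <= 1]].

Definition complementary A (t : R) : \bar R :=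
  ereal_sup [set (t * s)%:E - A s | s in [set s : R | (0 <= s)%R]].

Definition expsq (s : R) : \bar R := (expR (s ^+ 2) - 1)%:E.

Definition expL2 u : Prop := orlicz expsq u.
Definition expL2_norm u : \bar R := luxemburg expsq u.
Definition expL2_predual u : Prop := orlicz (complementary expsq) u.

End OrliczSpaces.

Section HeatEquation.
Variables (R : realType) (n : nat).
Implicit Types (g phi : Rn R n -> R) (u : R -> Rn R n -> R).

Definition heat_kernel (t : R) (x : Rn R n) : R :=
  (4 * pi * t) `^ (- (n%:R / 2)) * expR (- (normRn x ^+ 2 / (4 * t))).

Definition heat_semigroup (t : R) g (x : Rn R n) : \bar R :=
  (\int[lebesgueRn R n]_y (heat_kernel t (subRn x y) * g y)%:E)%E.

Definition nonlin (v : R) : R := `|v| `^ (4 / n%:R) * v * expR (v ^+ 2).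

Definition bounded_expL2 u : Prop :=
  exists M : R,
    {ae lebesgue_measure, forall t, 0 < t -> (expL2_norm (u t) <= M%:E)%E}.

Definition continuous_expL2 u : Prop :=
  forall t, 0 < t -> (fun s => expL2_norm (u s \- u t)) @ t --> 0%E.

(* In \bar R one has +oo - oo = -oo, so that this equality between a finite
   left-hand side and extended-real integrals entails their convergence. *)
Definition duhamel phi u : Prop :=
  forall t, 0 < t -> {ae lebesgueRn R n, forall x,
    (u t x)%:E = (heat_semigroup t phi x +
      \int[lebesgue_measure]_(s in `]0%R, t[)
        heat_semigroup (t - s) (nonlin \o u s) x)%E}.

Definition weak_star_initial phi u : Prop :=
  forall psi, expL2_predual psi ->
    (\int[lebesgueRn R n]_x ((u t x - phi x) * psi x)%:E)%E @[t --> 0^'+]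
      --> 0%E.

Definition mild_solution phi u : Prop :=
  [/\ forall t, 0 < t -> expL2 (u t),
      bounded_expL2 u, continuous_expL2 u,
      duhamel phi u & weak_star_initial phi u].

Definition positive_solution u : Prop :=
  forall t, 0 < t -> {ae lebesgueRn R n, forall x, 0 < u t x}.

(* Positive solutions with sup_(t > 0) |u(t)| <= 2 |phi| in exp L^2. *)
Definition small_positive_solution phi u : Prop :=
  [/\ mild_solution phi u, positive_solution u &
      (ereal_sup [set expL2_norm (u t) | t in [set t : R | (0 < t)%R]]
        <= 2%:E * expL2_norm phi)%E].

Definition unique_small_positive_solution phi u : Prop :=
  small_positive_solution phi u /\
  forall v, small_positive_solution phi v ->
    forall t, 0 < t -> {ae lebesgueRn R n, forall x, v t x = u t x}.

Definition Lp_norm (q : \bar R) g : \bar R :=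
  ('N[lebesgueRn R n]_q[EFin \o g])%E.

(* n/2 (1/r - 1/q), with 1/q = 0 for q = +oo *)
Definition decay_exponent (r : R) (q : \bar R) : R :=
  n%:R / 2 * (r^-1 - fine (q^-1)%E).

End HeatEquation.

(* Main.v *)
(* Let N = |phi|_{exp L^2} + |phi|_{L^p} with p = p_*, and beta = n/(2p).
   One shows |u(t)|_p <= 4N and |u(t)|_oo <= 4N t^(-beta) for all t > 0; the other
   norms follow by interpolation.

   The exp L^2 bound controls f(u(s)) in L^p and in L^n by M^(1+4/n), where M is
   slightly larger than |phi|_{exp L^2}. Hence on a bounded time interval (0, 2 tc)
   the Duhamel integral is negligible once M is small depending on tc. For s >= tc
   the claimed decay gives |f(u(s))|_p <= C s^(-2/p), whose integral over
   (tc, +oo) is small for tc large because p < 2. The two bounds are thus propagated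
   in time by an infimum-of-bad-times argument.

   For the little-o statement, f(u(s)) is also bounded in L^(p_1) with p_1 < p, so
   that the part of the Duhamel integral over (0, tc) decays faster than claimed,
   while the part over (tc, t) is as small as wanted; phi is split into a large
   part in L^(p_1) and a small part in L^p. *)
Require Import Defs.
From HB Require Import structures.
From mathcomp Require Import all_boot all_order all_algebra.
From mathcomp Require Import all_classical all_reals all_analysis.
From mathcomp Require Import measurable_realfun ess_sup_inf.
From mathcomp Require Import ring lra.
Set Implicit Arguments.
Unset Strict Implicit.
Unset Printing Implicit Defensive.
Import Order.TTheory GRing.Theory Num.Theory.
Import numFieldNormedType.Exports.
Local Open Scope classical_set_scope.
Local Open Scope ring_scope.

(** The lower bound 2n/(n+4) on the exponents r in use is the condition r (1 + 4/n) >= 2: |f(v)|^r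
    must vanish at 0 at least to the order of exp(v^2) - 1, whose integral the exp L^2 norm
    controls. The space L^n enters because the semigroup maps it to L^oo at the rate (t - s)^(-1/2),
    which is integrable up to s = t in every dimension; near s = t the decay is still to be proved
    and only the exp L^2 bound is at hand. The order of choices is what makes F depend on the
    L^{p_*} norm. The tail is proportional to N with a factor bounded in terms of that norm as long
    as M <= 1, so [tc] can be fixed before M; the surplus M^(4/n) of the nonlinearity then beats
    every constant depending on [tc]. The obstacle is measurability: u is continuous in time only
    for the exp L^2 norm, so Tonelli does not apply to the Duhamel integrand itself. Fatou's lemma
    yields a lower semicontinuity that suffices to dominate this integrand by a jointly measurable
    one with the same L^p bounds. *)

(** * Powers of real and extended real numbers *)

Lemma measurable_fun_powR d (T : measurableType d) (R : realType) (D : set T)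
    (f : T -> R) (p : R) :
  measurable_fun D f -> measurable_fun D (fun x => f x `^ p).
Proof. by move=> mf; exact: (measurableT_comp (measurable_powR p)). Qed.

Lemma ler_powR_inv (R : realType) (r a b : R) : 0 < r -> 0 <= a -> 0 <= b ->
  a `^ r <= b `^ r -> a <= b.
Proof.
move=> r0 a0 b0; apply: contraTT; rewrite -!ltNge => ba.
by rewrite gt0_ltr_powR.
Qed.

Lemma lee_poweR (R : realType) (r : R) (x y : \bar R) :
  0 <= r -> (0 <= x)%E -> (x <= y)%E -> (x `^ r <= y `^ r)%E.
Proof.
move=> r0 x0 xy; apply: gt0_ler_poweR; rewrite ?in_itv/= ?leey ?andbT//.
exact: le_trans xy.
Qed.

Lemma lee_poweR_inv (R : realType) (r b : R) (x : \bar R) :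
  0 < r -> (0 <= x)%E -> 0 <= b -> (x `^ r <= (b `^ r)%:E)%E -> (x <= b%:E)%E.
Proof.
move=> r0; case: x => [a||//]; last by rewrite poweRyr ?gt_eqF.
by rewrite poweR_EFin !lee_fin; exact: ler_powR_inv.
Qed.

(** * Comparison of integrals and Jensen's inequality *)

Section general.
Local Open Scope ereal_scope.
Context d (T : measurableType d) (R : realType).
Variable mu : {measure set T -> \bar R}.

(* No measurability is assumed: the integral of a nonnegative function is a
   supremum over the simple functions below it. *)
Lemma ge0_le_integral_nomeas (D : set T) (f g : T -> \bar R) :
  (forall x, D x -> 0 <= g x) -> (forall x, D x -> f x <= g x) ->
  \int[mu]_(x in D) f x <= \int[mu]_(x in D) g x.
Proof.
move=> g0 fg; rewrite integralE.
apply: (@le_trans _ _ (\int[mu]_(x in D) f^\+ x)).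
  by rewrite geeDl// oppe_le0 integral_ge0.
rewrite ge0_integralE// ge0_integralE//.
apply: ereal_sup_le => _ [h /= hf <-]; exists h => //= x.
apply: (le_trans (hf x)); rewrite /patch; case: ifPn => // /[!inE] Dx.
by rewrite funeposE ge_max fg// g0.
Qed.

(** Only an upper bound on the mass of the weight is asked for, so that the same inequality serves
    the heat kernel, of mass 1, and time weights known through an estimate. *)
Lemma integral_jensen (w g : T -> \bar R) (W p : R) :
  measurable_fun setT w -> measurable_fun setT g ->
  (forall x, 0 <= w x) -> (forall x, 0 <= g x) ->
  (0 < W)%R -> \int[mu]_x w x <= W%:E -> (1 <= p)%R ->
  (\int[mu]_x (g x * w x)) `^ p
    <= (W `^ (p - 1))%:E * \int[mu]_x (g x `^ p * w x).
Proof.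
move=> mw mg w0 g0 W0 wW; rewrite le_eqVlt => /predU1P[<-|p1].
  rewrite subrr powRr0 mul1e poweRe1; last first.
    by apply: integral_ge0 => x _; rewrite mule_ge0.
  by under [leRHS]eq_integral do rewrite poweRe1//.
have p0 : (0 < p)%R by rewrite (lt_trans _ p1).
set I := \int[mu]_x (g x * w x); set J := \int[mu]_x _.
have I0 : 0 <= I by apply: integral_ge0 => x _; rewrite mule_ge0.
have mgp : measurable_fun setT (fun x => g x `^ p).
  exact: (measurableT_comp (measurable_poweR _)).
have J0 : 0 <= J by apply: integral_ge0 => x _; rewrite mule_ge0// poweR_ge0.
pose q : R := (p / (p - 1))%R.
have q0 : (0 < q)%R by rewrite divr_gt0// subr_gt0.
have pq : (p^-1 + q^-1 = 1)%R.
  by rewrite /q invf_div -{1}(div1r p) -mulrDl subrKC mulfV// gt_eqF.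
(* Integrating Young's inequality [g c^(p-1) <= g^p / p + c^p / q]; Jensen's
   inequality is the case where [c] is the mean [I / W]. *)
have young (c : R) : (0 < c)%R ->
    (c `^ (p - 1))%:E * I <= (p^-1)%:E * J + (q^-1 * c `^ p * W)%:E.
  move=> c0; have mgw : measurable_fun setT (fun x => g x * w x).
    exact: emeasurable_funM.
  have mgpw : measurable_fun setT (fun x => g x `^ p * w x).
    exact: emeasurable_funM.
  rewrite -ge0_integralZl//; last 2 first.
  - by move=> x _; rewrite mule_ge0.
  - by rewrite lee_fin powR_ge0.
  rewrite -ge0_integralZl//; last 2 first.
  - by move=> x _; rewrite mule_ge0// poweR_ge0.
  - by rewrite lee_fin invr_ge0 ltW.
  apply: (@le_trans _ _ (\int[mu]_x ((p^-1)%:E * (g x `^ p * w x))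
      + (q^-1 * c `^ p)%:E * \int[mu]_x w x)); last first.
    rewrite leeD2l// [in leRHS]EFinM lee_wpmul2l//.
    by rewrite lee_fin mulr_ge0 ?powR_ge0// invr_ge0 ltW.
  rewrite -ge0_integralZl//; last first.
    by rewrite lee_fin mulr_ge0 ?powR_ge0// invr_ge0 ltW.
  rewrite -ge0_integralD//; last 4 first.
  - move=> x _; rewrite !mule_ge0 ?poweR_ge0//.
    by rewrite lee_fin invr_ge0 ltW.
  - exact: measurable_funeM.
  - move=> x _; rewrite mule_ge0//.
    by rewrite lee_fin mulr_ge0 ?powR_ge0// invr_ge0 ltW.
  - exact: measurable_funeM.
  apply: ge0_le_integral => //.
  - by move=> x _; rewrite !mule_ge0// lee_fin powR_ge0.
  - exact: measurable_funeM.
  - by apply: emeasurable_funD; exact: measurable_funeM.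
  move=> x _; rewrite !muleA -ge0_muleDl//; last 2 first.
  - by rewrite mule_ge0 ?poweR_ge0// lee_fin invr_ge0 ltW.
  - by rewrite lee_fin mulr_ge0 ?powR_ge0// invr_ge0 ltW.
  apply: lee_wpmul2r => //.
  have := g0 x; case: (g x) => [a a0|_|//]; last first.
    rewrite poweRyr ?gt_eqF// gt0_muley ?lte_fin ?powR_gt0//.
    by rewrite gt0_muley ?lte_fin ?invr_gt0// addye.
  rewrite poweR_EFin -!EFinM -EFinD lee_fin mulrC.
  have := @conjugate_powR _ a (c `^ (p - 1))%R p q a0 (powR_ge0 _ _) p0 q0 pq.
  rewrite -powRrM [((p - 1) * q)%R](_ : _ = p); last first.
    by rewrite /q mulrCA divff ?mulr1// gt_eqF// subr_gt0.
  by rewrite [(_ / p)%R]mulrC [(_ / q)%R]mulrC.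
have [Joo|Jfin] := eqVneq J +oo.
  by rewrite Joo gt0_muley ?leey// lte_fin powR_gt0.
have {}Jfin : J \is a fin_num by rewrite ge0_fin_numE// ltey.
(* Young's inequality at c = 1 already bounds [I] by finite quantities. *)
have Ifin : I \is a fin_num.
  rewrite ge0_fin_numE//; have := young 1%R ltr01.
  rewrite powR1 mul1e => /le_lt_trans; apply.
  by rewrite -(fineK Jfin) -EFinM -EFinD ltry.
have [I00|Ineq0] := eqVneq I 0.
  by rewrite I00 poweR0r ?gt_eqF// mule_ge0// lee_fin powR_ge0.
have {Ineq0} Igt0 : (0 < fine I)%R.
  by rewrite fine_gt0// lt_neqAle eq_sym Ineq0 I0 ltey_eq Ifin.
rewrite -(fineK Ifin) -(fineK Jfin) poweR_EFin -EFinM lee_fin.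
have := young (fine I / W)%R (divr_gt0 Igt0 W0).
rewrite -(fineK Ifin) -(fineK Jfin) -!EFinM -EFinD lee_fin !fineK//.
set i := fine I; set j := fine J => H.
(* At c = I/W both c^(p-1) I and c^p W equal (I/W)^p W: the term with 1/q moves to the left, where 1
   - 1/q = 1/p remains and cancels. *)
have Wi : ((i / W) `^ (p - 1) * i = (i / W) `^ p * W)%R.
  rewrite -[in RHS](@mulr_powRB1 _ (i / W) p)//; last by rewrite divr_ge0// ltW.
  by rewrite mulrAC divfK ?gt_eqF// mulrC.
rewrite Wi in H.
have {}H : ((i / W) `^ p * W <= j)%R.
  rewrite -(@ler_pM2l _ (p^-1)%R) ?invr_gt0//.
  have -> : (p^-1 = 1 - q^-1)%R by rewrite -pq addrK.
  by rewrite mulrBl mul1r mulrA lerBlDr (le_trans H)// -pq addrK.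
have -> : (i `^ p = W `^ (p - 1) * ((i / W) `^ p * W))%R.
  rewrite mulrCA [(W `^ _ * W)%R]mulrC mulr_powRB1// ?ltW//.
  rewrite -powRM ?divfK// ?gt_eqF ?ltW//.
  by rewrite divr_gt0.
by rewrite ler_pM2l// powR_gt0.
Qed.

End general.

(** * Minkowski's integral inequality *)

Section integral_minkowski.
Local Open Scope ereal_scope.
Context d1 d2 (S : measurableType d1) (T : measurableType d2) (R : realType).
Variables (m1 : {sigma_finite_measure set S -> \bar R})
          (m2 : {sigma_finite_measure set T -> \bar R}).

(** The norms of the slices enter through a strictly positive majorant [b], because the proof
    divides by it and the norms may vanish. Norm bounds are written as bounds on integrals of p-th
    powers, which avoids roots. *)
Lemma integral_minkowski (H : S * T -> \bar R) (D : set S) (b : S -> R)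
    (W p : R) :
  measurable D -> measurable_fun setT H -> (forall z, 0 <= H z) ->
  (forall s x, ~ D s -> H (s, x) = 0) ->
  measurable_fun setT b -> (forall s, 0 < b s)%R ->
  (forall s, D s -> \int[m2]_x H (s, x) `^ p <= (b s `^ p)%:E) ->
  (0 < W)%R -> \int[m1]_(s in D) (b s)%:E <= W%:E -> (1 <= p)%R ->
  \int[m2]_x (\int[m1]_s H (s, x)) `^ p <= (W `^ p)%:E.
Proof.
move=> mD mH H0 HD mb b0 Hb W0 bW p1.
have p0 : (0 < p)%R by rewrite (lt_le_trans _ p1).
(* Jensen's inequality for the weight [b], applied to [H / b], then Tonelli. *)
pose w s := (b s * \1_D s)%:E : \bar R.
have mw : measurable_fun setT w.
  by apply/measurable_EFinP/measurable_funM => //; exact: measurable_indic.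
have w0 s : 0 <= w s by rewrite lee_fin mulr_ge0// ltW.
have wW : \int[m1]_s w s <= W%:E.
  rewrite (le_trans _ bW)// [leRHS]integral_mkcond.
  rewrite le_eqVlt; apply/orP; left; apply/eqP/eq_integral => s _.
  rewrite /w patchE indicE; case: ifPn => _; by rewrite ?mulr1 ?mulr0.
pose g z := ((b z.1)^-1)%:E * H z.
have mb1 : measurable_fun setT (fun z : S * T => ((b z.1)^-1)%:E).
  apply/measurable_EFinP.
  rewrite [X in measurable_fun _ X](_ : _ = fun z => (b z.1 `^ (-1))%R).
    by apply: measurable_fun_powR; exact: measurableT_comp.
  by apply/funext => z; rewrite powR_inv1// ltW.
have mg : measurable_fun setT g by exact: emeasurable_funM.
have g0 z : 0 <= g z by rewrite mule_ge0// lee_fin invr_ge0 ltW.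
have gw s x : H (s, x) = g (s, x) * w s.
  rewrite /g /w indicE; have [Ds|Ds] := boolP (s \in D).
    by rewrite mulr1 muleAC -EFinM mulVf ?mul1e// gt_eqF.
  by rewrite HD ?mule0 ?mul0e//; rewrite notin_setE in Ds.
have mgp : measurable_fun setT (fun z : S * T => g z `^ p * w z.1).
  apply: emeasurable_funM; first exact: (measurableT_comp (measurable_poweR _)).
  exact: measurableT_comp.
have gp0 (z : S * T) : 0 <= g z `^ p * w z.1.
  by rewrite mule_ge0// poweR_ge0.
apply: (@le_trans _ _
  (\int[m2]_x ((W `^ (p - 1))%:E * \int[m1]_s (g (s, x) `^ p * w s)))).
  apply: ge0_le_integral => //.
  - by move=> x _; exact: poweR_ge0.
  - apply: (measurableT_comp (measurable_poweR _)) => //.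
    exact: (measurable_fun_fubini_tonelli_G _ mH H0).
  - apply: measurable_funeM.
    exact: (measurable_fun_fubini_tonelli_G _ mgp gp0).
  move=> x _; rewrite (eq_integral (fun s => g (s, x) * w s)); last first.
    by move=> s _; exact: gw.
  apply: integral_jensen => //.
  by apply: (measurableT_comp mg); exact: measurable_pair2.
rewrite ge0_integralZl//; last 3 first.
- exact: (measurable_fun_fubini_tonelli_G _ mgp gp0).
- by move=> x _; apply: integral_ge0 => s _; exact: (gp0 (s, x)).
- by rewrite lee_fin powR_ge0.
rewrite -(fubini_tonelli _ mgp gp0).
apply: (@le_trans _ _ ((W `^ (p - 1))%:E * \int[m1]_s w s)); last first.
  apply: (@le_trans _ _ ((W `^ (p - 1))%:E * W%:E)).
    by rewrite lee_wpmul2l// lee_fin powR_ge0.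
  by rewrite -EFinM mulrC mulr_powRB1// ltW.
rewrite lee_wpmul2l ?lee_fin ?powR_ge0//.
apply: ge0_le_integral => //.
- by move=> s _; apply: integral_ge0 => x _; exact: (gp0 (s, x)).
- exact: (measurable_fun_fubini_tonelli_F _ mgp gp0).
move=> s _ /=.
have mHs : measurable_fun setT (fun x => H (s, x)).
  by apply: (measurableT_comp mH); exact: measurable_pair1.
have [Ds|Ds] := pselect (D s); last first.
  rewrite integral0_eq// => x _.
  by rewrite /w indicE memNset// mulr0 mule0.
rewrite /g /=; under eq_integral.
  move=> x _; rewrite poweRM ?lee_fin ?invr_ge0 ?(ltW (b0 s))//.
  rewrite muleAC poweR_EFin; over.
rewrite ge0_integralZl//; last 3 first.
- exact: (measurableT_comp (measurable_poweR _)).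
- by move=> x _; exact: poweR_ge0.
- by rewrite mule_ge0// lee_fin powR_ge0.
apply: (@le_trans _ _ (((b s)^-1 `^ p)%:E * w s * (b s `^ p)%:E)).
  by rewrite lee_wpmul2l ?Hb// mule_ge0// lee_fin powR_ge0.
rewrite muleAC -EFinM -powRM ?invr_ge0 ?(ltW (b0 s))//.
by rewrite mulVf ?gt_eqF// powR1/= mul1r.
Qed.

End integral_minkowski.

(** * The Gaussian kernel in dimension n *)

Section heat_kernel.
Variable R : realType.
Local Notation mu := (@lebesgue_measure R).

(** Tonelli's theorem transported along [consRn]: the measure on dimension n+1 is the image of a
    product, and this is the step that allows induction on the dimension. *)
Lemma ge0_integral_lebesgueRnS n (f : Rn R n.+1 -> \bar R) :
  measurable_fun setT f -> (forall x, 0 <= f x)%E ->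
  (\int[lebesgueRn R n.+1]_x f x =
   \int[mu]_a \int[lebesgueRn R n]_x f (consRn (a, x)))%E.
Proof.
move=> mf f0; have mc := @measurable_consRn R n.
transitivity (\int[(mu \x lebesgueRn R n)%E]_z (f \o @consRn R n) z)%E.
  rewrite -[RHS](@ge0_integral_pushforward _ _ _ _ _ _ mc _ setT f)//.
rewrite (@fubini_tonelli1 _ _ _ _ _ _ _ (f \o @consRn R n))//.
  exact: measurableT_comp.
by move=> z /=; exact: f0.
Qed.

Definition heat1 (t a b : R) : R :=
  (4 * pi * t) `^ (- (1 / 2)) * expR (- ((a - b) ^+ 2 / (4 * t))).

(** The one-dimensional heat kernel is the Gaussian density of mean [a] and variance 2t, from which
    it inherits mass 1. *)
Lemma heat1E (t a b : R) : 0 < t ->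
  heat1 t a b = normal_pdf a (Num.sqrt (2 * t)) b.
Proof.
move=> t0; rewrite normal_pdfE ?gt_eqF ?sqrtr_gt0 ?mulr_gt0// /heat1.
have pi0 := pi_gt0 R.
rewrite /normal_peak /normal_fun sqr_sqrtr ?mulr_ge0 ?(ltW t0)//.
rewrite powRN div1r powR12_sqrt ?mulr_ge0 ?(ltW t0) ?(ltW pi0)//.
congr (_^-1 * expR _); first by congr Num.sqrt; ring.
rewrite -sqrrN opprB mulNr; congr (- (_ / _)); ring.
Qed.

Lemma integral_heat1 (t a : R) : 0 < t -> (\int[mu]_b (heat1 t a b)%:E = 1)%E.
Proof.
move=> t0; under eq_integral do rewrite heat1E//.
exact: integral_normal_pdf.
Qed.

Lemma heat_kernel_sub n (t : R) (x y : Rn R n) :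
  heat_kernel t (subRn x y) = (4 * pi * t) `^ (- (n%:R / 2)) *
    expR (- ((\sum_(i < n) (tnth x i - tnth y i) ^+ 2) / (4 * t))).
Proof.
rewrite /heat_kernel /normRn sqr_sqrtr.
  by under eq_bigr do rewrite tnth_mktuple.
by apply: sumr_ge0 => i _; exact: sqr_ge0.
Qed.

Lemma heat_kernelC n (t : R) (x y : Rn R n) :
  heat_kernel t (subRn x y) = heat_kernel t (subRn y x).
Proof.
rewrite heat_kernel_sub heat_kernel_sub.
rewrite (eq_bigr (fun i => (tnth y i - tnth x i) ^+ 2))// => i _.
by rewrite -sqrrN opprB.
Qed.

Lemma heat_kernel_gt0 n (t : R) (x : Rn R n) : 0 < t -> 0 < heat_kernel t x.
Proof.
by move=> t0; rewrite mulr_gt0 ?expR_gt0// powR_gt0// !mulr_gt0// pi_gt0.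
Qed.

(** The factor (4 pi)^(-n/2) is at most 1 and is dropped, so that the smoothing estimates below have
    constant 1. *)
Lemma heat_kernel_le n (t : R) (x : Rn R n) : 0 < t ->
  heat_kernel t x <= t `^ (- (n%:R / 2)).
Proof.
move=> t0; rewrite -[leRHS]mulr1 ler_pM ?powR_ge0 ?expR_ge0//.
  rewrite !powRN lef_pV2 ?posrE ?powR_gt0 ?mulr_gt0 ?pi_gt0//.
  rewrite ge0_ler_powR ?nnegrE ?divr_ge0 ?mulr_ge0 ?(ltW t0) ?(ltW (pi_gt0 R))//.
  rewrite ler_peMl ?(ltW t0)//; have := pi_ge2 R; lra.
by rewrite -expR0 ler_expR oppr_le0 divr_ge0 ?sqr_ge0// mulr_ge0 ?(ltW t0).
Qed.

Lemma heat_kernel_cons n (t a b : R) (x y : Rn R n) : 0 < t ->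
  heat_kernel t (subRn (consRn (a, x)) (consRn (b, y))) =
  heat1 t a b * heat_kernel t (subRn x y).
Proof.
move=> t0; rewrite !heat_kernel_sub big_ord_recl/= /heat1 mulrACA -expRD.
have c0 : 4 * pi * t != 0 by rewrite gt_eqF// !mulr_gt0// pi_gt0.
rewrite -powRD; last by rewrite c0 implybT.
congr (_ `^ _ * expR _); first by rewrite -natr1; field.
rewrite -opprD -mulrDl; congr (- (_ / _)); congr (_ + _).
by apply: eq_bigr => i _; rewrite !tnthS.
Qed.

Lemma measurable_heat_kernel d (T : measurableType d) n (t : T -> R)
    (f g : T -> Rn R n) :
  measurable_fun setT t -> measurable_fun setT f -> measurable_fun setT g ->
  measurable_fun setT (fun z => heat_kernel (t z) (subRn (f z) (g z))).
Proof.
move=> mt mf mg.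
rewrite [X in measurable_fun _ X](_ : _ = fun z =>
   (4 * pi * t z) `^ (- (n%:R / 2)) *
    expR (- ((\sum_(i < n) (tnth (f z) i - tnth (g z) i) ^+ 2) *
      (4 * t z)^-1))); last by apply/funext => z; rewrite heat_kernel_sub.
apply: measurable_funM.
  by apply: measurable_fun_powR; exact: measurable_funM.
apply: (measurableT_comp (@measurable_expR R)).
apply: measurable_funN; apply: measurable_funM.
  apply: measurable_sum => i; apply: measurable_funX; apply: measurable_funB.
    by apply: (measurableT_comp (measurable_tnth i)).
  by apply: (measurableT_comp (measurable_tnth i)).
(* The power -1 agrees with the inverse only on nonnegative numbers; negative times are handled by
   oddness. *)
rewrite [X in measurable_fun _ X](_ : _ = fun z =>
  if 0 <= t z then (4 * t z) `^ (-1) else - ((4 * (- t z)) `^ (-1))).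
  by apply: measurable_fun_ifT; [exact: measurable_fun_ler|
    apply: measurable_fun_powR; exact: measurable_funM|
    apply: measurable_funN; apply: measurable_fun_powR;
    apply: measurable_funM => //; exact: measurable_funN].
apply/funext => z; case: ifPn => [tz|]; first by rewrite powR_inv1 ?mulr_ge0.
rewrite -ltNge => tz; rewrite powR_inv1 ?mulr_ge0// ?oppr_ge0 ?ltW//.
by rewrite mulrN invrN opprK.
Qed.

Lemma integral_heat_kernel n (t : R) (x : Rn R n) : 0 < t ->
  (\int[lebesgueRn R n]_y (heat_kernel t (subRn x y))%:E = 1)%E.
Proof.
move=> t0; elim: n x => [x|n IHn x].
  rewrite integral_dirac//; last first.
    by apply/measurable_EFinP; apply: measurable_heat_kernel.
  by rewrite diracT mul1e heat_kernel_sub big_ord0 mul0r oppr0 mul0r oppr0 expR0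
    powRr0 mulr1.
rewrite ge0_integral_lebesgueRnS; last 2 first.
- by apply/measurable_EFinP; apply: measurable_heat_kernel.
- by move=> y; rewrite lee_fin ltW// heat_kernel_gt0.
rewrite (tuple_eta x).
under eq_integral => a _.
  under eq_integral.
    move=> y _.
    rewrite (@heat_kernel_cons _ t (thead x) a [tuple of behead x] y t0) EFinM.
    over.
  rewrite ge0_integralZl//; last 3 first.
  - by apply/measurable_EFinP; apply: measurable_heat_kernel.
  - by move=> y _; rewrite lee_fin ltW// heat_kernel_gt0.
  - by rewrite lee_fin mulr_ge0 ?powR_ge0 ?expR_ge0.
  rewrite IHn mule1.
  over.
exact: integral_heat1.
Qed.

End heat_kernel.

(** * Smoothing estimates for the heat semigroup *)

Section heat_semigroup.
Variables (R : realType) (n : nat).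
Local Notation mu := (lebesgueRn R n).
Implicit Types (g : Rn R n -> R) (t r p K : R).

Lemma heat_semigroup_ge0 t g x : 0 < t -> (forall y, 0 <= g y) ->
  (0 <= heat_semigroup t g x)%E.
Proof.
move=> t0 g0; apply: integral_ge0 => y _.
by rewrite lee_fin mulr_ge0// ltW// heat_kernel_gt0.
Qed.

Lemma le_heat_semigroup t g h x : 0 < t -> (forall y, 0 <= h y) ->
  (forall y, g y <= h y) -> (heat_semigroup t g x <= heat_semigroup t h x)%E.
Proof.
move=> t0 h0 gh; have G0 y := ltW (heat_kernel_gt0 (subRn x y) t0).
apply: ge0_le_integral_nomeas => y _; first by rewrite lee_fin mulr_ge0.
by rewrite lee_fin ler_wpM2l.
Qed.

Lemma measurable_heat_integrand t g : measurable_fun setT g ->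
  measurable_fun setT (fun z : Rn R n * Rn R n =>
    (heat_kernel t (subRn z.1 z.2) * g z.2)%:E).
Proof.
move=> mg; apply/measurable_EFinP; apply: measurable_funM.
  exact: measurable_heat_kernel.
exact: measurableT_comp.
Qed.

Lemma measurable_heat_semigroup t g : 0 < t ->
  measurable_fun setT g -> (forall y, 0 <= g y) ->
  measurable_fun setT (heat_semigroup t g).
Proof.
move=> t0 mg g0; have mG := measurable_heat_integrand t mg.
apply: (measurable_fun_fubini_tonelli_F _ mG) => z.
by rewrite lee_fin mulr_ge0// ltW// heat_kernel_gt0.
Qed.

Lemma heat_semigroup_jensen t g r x : 0 < t ->
  measurable_fun setT g -> (forall y, 0 <= g y) -> 1 <= r ->
  (heat_semigroup t g x `^ r <= heat_semigroup t (fun y => g y `^ r)%R x)%E.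
Proof.
move=> t0 mg g0 r1; have G0 y := ltW (heat_kernel_gt0 (subRn x y) t0).
pose w y := (heat_kernel t (subRn x y))%:E.
have mw : measurable_fun setT w.
  by apply/measurable_EFinP; exact: measurable_heat_kernel.
have w1 : (\int[mu]_y w y <= 1%:E)%E by rewrite integral_heat_kernel.
have mg' : measurable_fun setT (EFin \o g) by exact/measurable_EFinP.
have := integral_jensen mw mg' (fun y => G0 y) (fun y => g0 y) ltr01 w1 r1.
rewrite powR1/= mul1e /w => H.
rewrite /heat_semigroup; under eq_integral do rewrite mulrC EFinM.
by under [leRHS]eq_integral do rewrite mulrC EFinM -poweR_EFin.
Qed.

(** Jensen's inequality followed by Tonelli: by symmetry the kernel has mass 1 in [x] as well. *)
Lemma heat_semigroup_contract t g r : 0 < t ->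
  measurable_fun setT g -> (forall y, 0 <= g y) -> 1 <= r ->
  (\int[mu]_x heat_semigroup t g x `^ r <= \int[mu]_y (g y `^ r)%:E)%E.
Proof.
move=> t0 mg g0 r1.
have G0 x y := ltW (@heat_kernel_gt0 R n t (subRn x y) t0).
have mgr : measurable_fun setT (fun y => g y `^ r)%R by exact: measurable_fun_powR.
have gr0 y : 0 <= g y `^ r by exact: powR_ge0.
apply: (@le_trans _ _ (\int[mu]_x heat_semigroup t (fun y => g y `^ r)%R x)%E).
  apply: ge0_le_integral => //.
  - by move=> x _; exact: poweR_ge0.
  - apply: (measurableT_comp (measurable_poweR _)).
    exact: measurable_heat_semigroup.
  - exact: measurable_heat_semigroup.
  - by move=> x _; exact: heat_semigroup_jensen.
have mF := measurable_heat_integrand t mgr.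
rewrite /heat_semigroup (fubini_tonelli _ mF) /=; last first.
  by move=> z; rewrite lee_fin mulr_ge0.
rewrite le_eqVlt; apply/orP; left; apply/eqP; apply: eq_integral => y _.
under eq_integral do rewrite mulrC EFinM heat_kernelC.
rewrite ge0_integralZl//.
- by rewrite integral_heat_kernel// mule1.
- by apply/measurable_EFinP; exact: measurable_heat_kernel.
- by move=> x _; rewrite lee_fin.
- by rewrite lee_fin.
Qed.

Lemma heat_semigroup_le_sup t g r K x : 0 < t ->
  measurable_fun setT g -> (forall y, 0 <= g y) -> 1 <= r -> 0 <= K ->
  (\int[mu]_y (g y `^ r)%:E <= (K `^ r)%:E)%E ->
  (heat_semigroup t g x <= (t `^ (- (n%:R / (2 * r))) * K)%:E)%E.
Proof.
move=> t0 mg g0 r1 K0 gK; have r0 : 0 < r by rewrite (lt_le_trans _ r1).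
have tr0 : 0 <= t `^ (- (n%:R / (2 * r))) * K by rewrite mulr_ge0// powR_ge0.
have H : (heat_semigroup t g x `^ r <=
    ((t `^ (- (n%:R / (2 * r))) * K) `^ r)%:E)%E.
  rewrite (le_trans (heat_semigroup_jensen _ _ _ _ _))//.
  apply: (@le_trans _ _
      (\int[mu]_y ((t `^ (- (n%:R / 2)))%:E * (g y `^ r)%:E))%E).
    apply: ge0_le_integral_nomeas => y _; rewrite -EFinM lee_fin.
      by rewrite mulr_ge0// powR_ge0.
    by rewrite ler_wpM2r ?powR_ge0// heat_kernel_le.
  rewrite ge0_integralZl//; last 3 first.
  - by apply/measurable_EFinP; exact: measurable_fun_powR.
  - by move=> y _; rewrite lee_fin powR_ge0.
  - by rewrite lee_fin powR_ge0.
  rewrite powRM ?powR_ge0// -powRrM EFinM.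
  rewrite [(- (n%:R / (2 * r)) * r)](_ : _ = - (n%:R / 2)); last first.
    by field; rewrite gt_eqF.
  by rewrite lee_wpmul2l// lee_fin powR_ge0.
by apply: lee_poweR_inv H => //; exact: heat_semigroup_ge0.
Qed.

(** Interpolation: p - r powers are estimated by the pointwise bound [S], the other r powers by the
    contraction in L^r. *)
Lemma heat_semigroup_le_powR t g r p K : 0 < t ->
  measurable_fun setT g -> (forall y, 0 <= g y) -> 1 <= r -> r <= p ->
  0 <= K -> (\int[mu]_y (g y `^ r)%:E <= (K `^ r)%:E)%E ->
  (\int[mu]_x heat_semigroup t g x `^ p <=
    ((t `^ (- (n%:R / 2 * (r^-1 - p^-1))) * K) `^ p)%:E)%E.
Proof.
move=> t0 mg g0 r1 rp K0 gK; have r0 : 0 < r by rewrite (lt_le_trans _ r1).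
have p0 : 0 < p by rewrite (lt_le_trans r0).
pose S := t `^ (- (n%:R / (2 * r))) * K.
have S0 : 0 <= S by rewrite mulr_ge0// powR_ge0.
have -> : (t `^ (- (n%:R / 2 * (r^-1 - p^-1))) * K) `^ p =
    S `^ (p - r) * K `^ r.
  rewrite !powRM ?powR_ge0// -!powRrM -[_ * _ * K `^ r]mulrA -powRD.
    rewrite subrK; congr (_ `^ _ * _); field.
    by rewrite !gt_eqF.
  by rewrite subrK gt_eqF.
apply: (@le_trans _ _
    (\int[mu]_x ((S `^ (p - r))%:E * heat_semigroup t g x `^ r))%E).
  apply: ge0_le_integral_nomeas => x _.
    by rewrite mule_ge0 ?poweR_ge0// lee_fin powR_ge0.
  have := heat_semigroup_le_sup x t0 mg g0 r1 K0 gK.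
  have := heat_semigroup_ge0 x t0 g0.
  case: (heat_semigroup t g x) => // a; rewrite !poweR_EFin -EFinM !lee_fin.
  move=> a0 aS.
  have -> : a `^ p = a `^ (p - r) * a `^ r.
    by rewrite -powRD ?subrK// gt_eqF.
  by rewrite ler_wpM2r ?powR_ge0// ge0_ler_powR// subr_ge0.
rewrite ge0_integralZl//; last 3 first.
- apply: (measurableT_comp (measurable_poweR _)).
  exact: measurable_heat_semigroup.
- by move=> x _; exact: poweR_ge0.
- by rewrite lee_fin powR_ge0.
rewrite EFinM lee_wpmul2l ?lee_fin ?powR_ge0//.
by rewrite (le_trans _ gK)// heat_semigroup_contract.
Qed.

Lemma heat_semigroup_le_cst t g K x : 0 < t -> measurable_fun setT g ->
  (forall y, 0 <= g y) -> {ae mu, forall y, g y <= K} -> 0 <= K ->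
  (heat_semigroup t g x <= K%:E)%E.
Proof.
move=> t0 mg g0 gK K0; have G0 y := ltW (heat_kernel_gt0 (subRn x y) t0).
have mG : measurable_fun setT (fun y => heat_kernel t (subRn x y)).
  exact: measurable_heat_kernel.
apply: (@le_trans _ _ (\int[mu]_y (K%:E * (heat_kernel t (subRn x y))%:E))%E).
  apply: ae_ge0_le_integral => //.
  - by move=> y _; rewrite lee_fin mulr_ge0.
  - by apply/measurable_EFinP; exact: measurable_funM.
  - by move=> y _; rewrite -EFinM lee_fin mulr_ge0.
  - by apply: measurable_funeM; exact/measurable_EFinP.
  - by apply: filterS gK => y gyK _; rewrite -EFinM lee_fin mulrC ler_wpM2r.
rewrite ge0_integralZl//; last 2 first.
- exact/measurable_EFinP.
- by move=> y _; rewrite lee_fin.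
by rewrite integral_heat_kernel// mule1.
Qed.

End heat_semigroup.

(** * The exp L^2 norm and the nonlinearity *)

Section expL2.
Variables (R : realType) (n : nat).
Local Notation mu := (lebesgueRn R n).
Implicit Types (v : Rn R n -> R) (l r x : R).

(** With e = exp(x/2) >= 1 + x/2, the left side is at most 2 (e - 1) e <= 2 (e^2 - 1). Half of the
    exponential is thus left free to absorb other factors. *)
Lemma mulr_expR_half_le x : 0 <= x -> x * expR (x / 2) <= 2 * (expR x - 1).
Proof.
move=> x0; have e1 : 1 + x / 2 <= expR (x / 2) by exact: expR_ge1Dx.
have -> : expR x = expR (x / 2) * expR (x / 2) by rewrite -expRD -splitr.
have := expR_gt0 (x / 2); set e := expR (x / 2) in e1 *; nra.
Qed.

Lemma powR_le_expR_sqr (b y : R) : 0 <= b -> 0 < y ->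
  y `^ b <= expR (b ^+ 2 + y ^+ 2 / 4).
Proof.
move=> b0 y0; rewrite /powR gt_eqF// ler_expR.
have ly : ln y <= y.
  by rewrite -ler_expR lnK ?posrE// (le_trans _ (expR_ge1Dx _))// lerDr.
rewrite (le_trans (ler_wpM2l b0 ly))//.
have := sqr_ge0 (b - y / 2); rewrite sqrrB; nra.
Qed.

Lemma expsq_ge0 y : (0 <= expsq y :> \bar R)%E.
Proof. by rewrite lee_fin subr_ge0 -expR0 ler_expR sqr_ge0. Qed.

Lemma measurable_expsq d (T : measurableType d) (g : T -> R) :
  measurable_fun setT g -> measurable_fun setT (fun z => expsq (g z)).
Proof.
move=> mg; apply/measurable_EFinP; apply: measurable_funB => //.
by apply: (measurableT_comp (@measurable_expR R)); exact: measurable_funX.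
Qed.

(** The strict inequality supplies an admissible l' < l, and the modular decreases in l; it need not
    be known whether the infimum is attained. *)
Lemma expL2_norm_lt v l : (expL2_norm v < l%:E)%E -> measurable_fun setT v ->
  0 < l /\ (orlicz_modular (@expsq R) v l <= 1)%E.
Proof.
move=> /ereal_inf_lt[_ [l' [l'0 vl'] <-]]; rewrite lte_fin => l'l mv.
have l0 : 0 < l by rewrite (lt_trans l'0).
split; first exact: l0.
apply: le_trans vl'; apply: ge0_le_integral_nomeas => x _.
  exact: expsq_ge0.
rewrite lee_fin lerB// ler_expR ler_pXn2r ?nnegrE ?divr_ge0 ?(ltW l0) ?(ltW l'0)//.
by rewrite ler_wpM2l// lef_pV2 ?posrE// ltW.
Qed.

(** Since s^2 <= exp(s^2) - 1, exp L^2 embeds in L^2; this turns continuity in exp L^2 into almost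
    everywhere convergence along a sequence of times. *)
Lemma integral_sqr_le v l : 0 < l -> measurable_fun setT v ->
  (orlicz_modular (@expsq R) v l <= 1)%E ->
  (\int[mu]_x (v x ^+ 2)%:E <= (l ^+ 2)%:E)%E.
Proof.
move=> l0 mv vl.
apply: (@le_trans _ _ (\int[mu]_x ((l ^+ 2)%:E * expsq (`|v x| / l)))%E).
  apply: ge0_le_integral_nomeas => x _.
    by rewrite mule_ge0 ?expsq_ge0// lee_fin sqr_ge0.
  rewrite -EFinM lee_fin -(@ler_pM2l _ (l ^- 2)) ?invr_gt0 ?exprn_gt0//.
  rewrite mulKf ?expf_neq0 ?gt_eqF//.
  have := expR_ge1Dx ((`|v x| / l) ^+ 2).
  by rewrite expr_div_n real_normK ?num_real// [_ / l ^+ 2]mulrC; lra.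
rewrite ge0_integralZl//; last 3 first.
- apply: measurable_expsq; apply: measurable_funM => //.
  exact: measurableT_comp.
- by move=> x _; exact: expsq_ge0.
- by rewrite lee_fin sqr_ge0.
by rewrite -[leRHS]mule1 lee_wpmul2l// lee_fin sqr_ge0.
Qed.

(** A bound for the L^r norm of [nonlin n v] when the exp L^2 norm of v is less than l. The power of
    l is the growth of f near 0; the other factor does not involve l. *)
Definition kappa (r l : R) : R :=
  l `^ (1 + 4 / n%:R) * (2 * expR ((r * (1 + 4 / n%:R) - 2) ^+ 2)) `^ r^-1.

(** Put z = |y|/l and a = r (1 + 4/n), so that the left side is l^a z^a exp(r l^2 z^2). Split z^a as
    z^2 z^(a-2), which needs a >= 2. The factor z^(a-2) costs exp((a-2)^2 + z^2/4), the last
    exponential at most exp(z^2/4), and z^2 exp(z^2/2) is bounded by 2 (exp(z^2) - 1). *)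
Lemma nonlin_powR_le (r l y : R) : 0 < r -> 0 < l -> r * l ^+ 2 <= 4^-1 ->
  2 <= r * (1 + 4 / n%:R) ->
  ((`|nonlin n y| `^ r)%:E <= (kappa r l `^ r)%:E * expsq (`|y| / l))%E.
Proof.
move=> r0 l0 rl ra; set a := r * (1 + 4 / n%:R) in ra.
have n40 : (0 : R) <= 4 / n%:R by rewrite divr_ge0.
have K0 : 0 <= kappa r l by rewrite mulr_ge0 ?powR_ge0.
have [->|y0] := eqVneq y 0.
  rewrite /nonlin mulr0 mul0r normr0 powR0 ?gt_eqF//.
  by rewrite mule_ge0 ?expsq_ge0// lee_fin powR_ge0.
have [z [z0 yE]] : exists z, 0 < z /\ `|y| = l * z.
  exists (`|y| / l); split; first by rewrite divr_gt0// normr_gt0.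
  by rewrite mulrCA divff ?mulr1// gt_eqF.
rewrite -EFinM lee_fin yE [l * z / l]mulrAC divff ?gt_eqF// mul1r.
rewrite /nonlin 2!normrM (ger0_norm (powR_ge0 _ _)) (ger0_norm (expR_ge0 _)).
have -> : y ^+ 2 = (l * z) ^+ 2 by rewrite -yE real_normK ?num_real.
rewrite yE -{2}(powRr1 (ltW (mulr_gt0 l0 z0))) -powRD; last first.
  by rewrite (gt_eqF (mulr_gt0 l0 z0)) implybT.
rewrite [4 / _ + 1]addrC.
rewrite !powRM ?mulr_ge0 ?powR_ge0 ?expR_ge0 ?(ltW l0) ?(ltW z0)//.
rewrite -!powRrM [(1 + _) * r]mulrC -/a.
rewrite mulVf ?gt_eqF// !powRr1 ?expR_ge0//.
rewrite -[_ * _ * _ `^ r]mulrA -[_ * _ * (expR _ - 1)]mulrA ler_pM2l ?powR_gt0//.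
rewrite [_ `^ r](_ : _ = expR (r * l ^+ 2 * z ^+ 2)); last first.
  by rewrite /powR gt_eqF ?expR_gt0// expRK exprMn mulrA.
have -> : z `^ a = z ^+ 2 * z `^ (a - 2).
  rewrite -powR_mulrn ?ltW// -powRD ?(gt_eqF z0) ?implybT//.
  by rewrite addrC subrK.
have zE : z `^ (a - 2) <= expR ((a - 2) ^+ 2 + z ^+ 2 / 4).
  by rewrite powR_le_expR_sqr// subr_ge0.
have zl : expR (r * l ^+ 2 * z ^+ 2) <= expR (z ^+ 2 / 4).
  by rewrite ler_expR mulrC ler_wpM2l// sqr_ge0.
rewrite -[_ * _ * expR _]mulrA; apply: (@le_trans _ _ (z ^+ 2 *
    (expR ((a - 2) ^+ 2 + z ^+ 2 / 4) * expR (z ^+ 2 / 4)))).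
  by rewrite ler_wpM2l ?sqr_ge0// ler_pM ?powR_ge0 ?expR_ge0.
rewrite expRD -[expR _ * _ * _]mulrA -expRD mulrCA [2 * _]mulrC -[leRHS]mulrA ler_wpM2l ?expR_ge0//.
rewrite -mulrDr (_ : 4^-1 + 4^-1 = 2^-1); last by field.
exact/mulr_expR_half_le/sqr_ge0.
Qed.

Lemma measurable_nonlin d (T : measurableType d) (g : T -> R) :
  measurable_fun setT g -> measurable_fun setT (fun z => nonlin n (g z)).
Proof.
move=> mg; apply: measurable_funM.
  apply: measurable_funM => //; apply: measurable_fun_powR.
  exact: measurableT_comp.
by apply: (measurableT_comp (@measurable_expR R)); exact: measurable_funX.
Qed.

Lemma integral_nonlin_le v (r l : R) : 0 < r -> r * l ^+ 2 <= 4^-1 ->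
  2 <= r * (1 + 4 / n%:R) -> measurable_fun setT v ->
  (expL2_norm v < l%:E)%E ->
  (\int[mu]_x (`|nonlin n (v x)| `^ r)%:E <= (kappa r l `^ r)%:E)%E.
Proof.
move=> r0 rl ra mv /expL2_norm_lt/(_ mv)[l0 vl].
apply: (@le_trans _ _
    (\int[mu]_x ((kappa r l `^ r)%:E * expsq (`|v x| / l)))%E).
  apply: ge0_le_integral_nomeas => x _; last exact: nonlin_powR_le.
  by rewrite mule_ge0 ?expsq_ge0// lee_fin powR_ge0.
rewrite ge0_integralZl//; last 3 first.
- apply: measurable_expsq; apply: measurable_funM => //.
  exact: measurableT_comp.
- by move=> x _; exact: expsq_ge0.
- by rewrite lee_fin powR_ge0.
by rewrite -[leRHS]mule1 lee_wpmul2l// lee_fin powR_ge0.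
Qed.

End expL2.

(** * Almost everywhere convergence and lower limits *)

Lemma powR_cvg_gt0 (R : realType) (T : Type) (F : set_system T) (FF : Filter F)
    (f : T -> R) (x a : R) :
  0 < x -> f @ F --> x -> (fun z => f z `^ a) @ F --> x `^ a.
Proof.
move=> x0 fx; apply: (cvg_comp f (fun z => z `^ a) fx).
have : {for x, continuous ((@powR R) ^~ a)}; last by [].
apply/differentiable_continuous/derivable1_diffP.
by apply: derivable_powR; rewrite in_itv/= x0.
Qed.

Lemma expR_cvg (R : realType) (T : Type) (F : set_system T) (FF : Filter F)
    (f : T -> R) (x : R) :
  f @ F --> x -> (fun z => expR (f z)) @ F --> expR x.
Proof. by move=> fx; apply: (cvg_comp f expR fx); exact: continuous_expR. Qed.

(** The series of the squares has finite integral, hence is finite almost everywhere, and there its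
    terms tend to 0. *)
Lemma ae_cvg0_of_sqr d (T : measurableType d) (R : realType)
    (mu : {measure set T -> \bar R}) (v : nat -> T -> R) :
  (forall k, measurable_fun setT (v k)) ->
  (forall k, (\int[mu]_x (v k x ^+ 2)%:E <= (1 / (2 ^ (k + 1))%:R)%:E)%E) ->
  {ae mu, forall x, v k x @[k --> \oo] --> 0}.
Proof.
move=> mv vk.
pose f k x := (v k x ^+ 2)%:E.
have mf k : measurable_fun setT (f k).
  by apply/measurable_EFinP; exact: measurable_funX.
have f0 k x : (0 <= f k x)%E by rewrite lee_fin sqr_ge0.
have fI : (\int[mu]_x \sum_(0 <= k <oo) f k x < +oo)%E.
  rewrite integral_nneseries//.
  apply: (@le_lt_trans _ _ (\sum_(0 <= k <oo) (1 / (2 ^ (k + 1))%:R)%:E)%E).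
    by apply: lee_nneseries => k _; rewrite ?vk// integral_ge0.
  have /cvg_lim := @cvg_geometric_eseries_half R 1 0.
  rewrite /eseries/= => ->//.
  by rewrite ltry.
have If : mu.-integrable setT (fun x => \sum_(0 <= k <oo) f k x)%E.
  apply/integrableP; split; first exact: ge0_emeasurable_sum.
  by under eq_integral do rewrite gee0_abs ?nneseries_ge0//.
apply: filterS (integrable_ae measurableT If) => x /(_ I).
rewrite ge0_fin_numE ?nneseries_ge0// => fx.
have t0 := nneseries_tail_cvg fx (fun k _ => f0 k x).
have : f ^~ x @ \oo --> 0%E.
  apply: (squeeze_cvge _ (cvg_cst 0%E) t0).
  apply: nearW => k; rewrite f0/= (nneseries_split k 1)//.
  by rewrite addn1 big_nat1 leeDl// nneseries_ge0.
move=> /fine_cvgP[_] /= H.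
have {H} : (fun k => Num.sqrt (v k x ^+ 2)) @ \oo --> Num.sqrt (0 : R).
  by apply: (cvg_comp _ _ H); exact: sqrt_continuous.
rewrite sqrtr0; under eq_fun do rewrite sqrtr_sqr.
exact: norm_cvg0.
Qed.

Lemma limn_einf_ge0 (R : realType) (v : (\bar R)^nat) :
  (forall k, 0 <= v k)%E -> (0 <= limn_einf v)%E.
Proof.
move=> v0; rewrite limn_einf_lim; apply: lime_ge; first exact: is_cvg_einfs.
by apply: nearW => k; apply: le_ereal_inf_tmp => _ [m /= _ <-].
Qed.

Lemma limn_einf_le (R : realType) (v : (\bar R)^nat) (c : \bar R) :
  (\forall k \near \oo, (v k <= c)%E) -> (limn_einf v <= c)%E.
Proof.
move=> vc; rewrite limn_einf_lim; apply: lime_le; first exact: is_cvg_einfs.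
apply: filterS vc => k; apply: le_trans.
by apply: ereal_inf_lbound; exists k => /=.
Qed.

Lemma ereal_dense (R : realType) (a c : \bar R) :
  (a < c)%E -> exists b, (a < b < c)%E.
Proof.
case: a c => [a||] [c||] //.
- rewrite lte_fin => ac; exists ((a + c) / 2)%:E.
  by rewrite !lte_fin !midf_lt.
- by move=> _; exists (a + 1)%:E; rewrite lte_fin ltrDl ltr01 ltry.
- by move=> _; exists (c - 1)%:E; rewrite lte_fin ltrBlDr ltrDl ltr01 ltNyr.
- by move=> _; exists 0%E; rewrite ltNyr ltry.
Qed.

Lemma le_limn_einf (R : realType) (v : (\bar R)^nat) (c : \bar R) :
  (forall b, (b < c)%E -> \forall k \near \oo, (b <= v k)%E) ->
  (c <= limn_einf v)%E.
Proof.
move=> vc; rewrite leNgt; apply/negP => vltc.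
have [b /andP[vb bc]] := ereal_dense vltc.
have [N _ Nb] := vc b bc.
have : (b <= limn_einf v)%E; last by rewrite leNgt vb.
rewrite limn_einf_lim; apply: lime_ge; first exact: is_cvg_einfs.
exists N => // k /= Nk; apply: le_ereal_inf_tmp => _ [m /= km <-].
by apply: Nb; exact: leq_trans km.
Qed.

Lemma measurable_limn_einf d (T : measurableType d) (R : realType)
    (f : (T -> \bar R)^nat) :
  (forall k, measurable_fun setT (f k)) ->
  measurable_fun setT (fun x => limn_einf (f ^~ x)).
Proof.
move=> mf; rewrite [X in measurable_fun _ X](_ : _ =
  (\- (fun x => limn_esup ((fun k => (\- f k)) ^~ x)))%E)//.
apply: measurableT_comp => //; apply: measurable_fun_limn_esup => k.
exact: measurableT_comp.
Qed.

(** * Lower semicontinuity of the source in time *)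

Section lower_semicontinuity.
Variables (R : realType) (n : nat).
Local Notation mu := (lebesgueRn R n).

(* Along times [sk -> s] with [|u sk - u s|] summable in exp L^2, hence in L^2,
   one has [u sk -> u s] almost everywhere, so that Fatou applies. *)
Lemma heat_semigroup_lsc (u : R -> Rn R n -> R) (t s : R) (x : Rn R n)
    (c : \bar R) :
  (forall t, 0 < t -> measurable_fun setT (u t)) -> continuous_expL2 u ->
  0 < s -> s < t ->
  (c < heat_semigroup (t - s) (fun y => `|nonlin n (u s y)|)%R x)%E ->
  \forall s' \near s,
    (c < heat_semigroup (t - s') (fun y => `|nonlin n (u s' y)|)%R x)%E.
Proof.
move=> mu_ cu s0 st cs; apply: contrapT => Hc.
(* [e k] bounds both the time gap and the exp L^2 gap. As [e k <= 1], the integral of the squared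
   difference is at most (e k)^2 <= e k, which is summable. *)
pose e k : R := 1 / (2 ^ (k + 1))%:R.
have e0 k : 0 < e k by rewrite divr_gt0// ltr0n expn_gt0.
have exk k : exists s', [/\ 0 < s' < t, `|s' - s| < e k,
    (expL2_norm (u s' \- u s)%R < (e k)%:E)%E &
    (heat_semigroup (t - s') (fun y => `|nonlin n (u s' y)|)%R x <= c)%E].
  have nu := cu s s0 _ (@nbhs_open_ereal_lt _ 0 (fun=> e k) (e0 k)).
  apply: contrapT => Hk; apply: Hc.
  near=> s'; rewrite ltNge; apply/negP => hc; apply: Hk; exists s'; split => //.
  - apply/andP; split; near: s'; [exact: lt_nbhsr|exact: lt_nbhsl].
  - by near: s'; exact: nu.
have [sk /all_and4[]] := choice exk. move=> sk0t sks usk hk.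
have msk k : measurable_fun setT (u (sk k)).
  by apply: mu_; have /andP[] := sk0t k.
have mdk k : measurable_fun setT (u (sk k) \- u s).
  by apply: measurable_funB => //; exact: mu_.
have ek1 k : e k <= k.+1%:R^-1.
  rewrite /e div1r lef_pV2 ?posrE ?ltr0n ?expn_gt0// ler_nat addn1.
  exact/ltnW/ltn_expl.
have skcvg : sk @ \oo --> s.
  apply/cvgrPdist_lt => eps eps0; near=> k; rewrite distrC.
  apply: (lt_trans (sks k)); apply: (le_lt_trans (ek1 k)).
  by near: k; exact: near_infty_natSinv_lt (PosNum eps0).
have ae_u : {ae mu, forall y, u (sk k) y @[k --> \oo] --> u s y}.
  have := @ae_cvg0_of_sqr _ _ _ mu (fun k => u (sk k) \- u s) mdk.
  have H k : (\int[mu]_y ((u (sk k) \- u s)%R y ^+ 2)%:E <= (e k)%:E)%E.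
    have [ek0 /(integral_sqr_le ek0 (mdk k)) H] := expL2_norm_lt (usk k) (mdk k).
    rewrite (le_trans H)// lee_fin expr2 ler_piMr ?(ltW ek0)//.
    by rewrite (le_trans (ek1 k))// invf_le1 ?ler1n ?ltr0n.
  move=> /(_ H); apply: filterS => y Hy.
  have Hy' := cvgD Hy (cvg_cst (u s y)); rewrite add0r in Hy'.
  have <- : (fun k => (u (sk k) \- u s) y) \+ cst (u s y) =
    (fun k => u (sk k) y) by apply/funext => k /=; rewrite subrK.
  exact: Hy'.
pose F k y := (heat_kernel (t - sk k) (subRn x y) *
  `|nonlin n (u (sk k) y)|)%:E.
pose F0 y := (heat_kernel (t - s) (subRn x y) * `|nonlin n (u s y)|)%:E.
have mF k : measurable_fun setT (F k).
  apply/measurable_EFinP; apply: measurable_funM.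
    exact: measurable_heat_kernel.
  by apply: measurableT_comp => //; exact: measurable_nonlin.
have F_ge0 k y : (0 <= F k y)%E.
  rewrite lee_fin mulr_ge0// ltW// heat_kernel_gt0// subr_gt0.
  by have /andP[] := sk0t k.
have aeF : {ae mu, forall y, (F0 y <= limn_einf (F ^~ y))%E}.
  apply: filterS ae_u => y uy.
  (* [powR_cvg_gt0] needs a positive limit; where u s y = 0, [F0] vanishes and nonnegativity of the
     lower limit is enough. *)
  have [us0|us0] := eqVneq (u s y) 0.
    rewrite /F0 us0 /nonlin mulr0 mul0r normr0 mulr0.
    exact: limn_einf_ge0.
  rewrite (@cvg_limn_einf_sup _ _ (F0 y))// /F /F0; apply: cvg_EFin.
    exact: nearW.
  have tsk : (fun k => 4 * (t - sk k)) @ \oo --> 4 * (t - s).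
    by apply: cvgM; [exact: cvg_cst|apply: cvgB => //; exact: cvg_cst].
  have ts0 : 0 < 4 * (t - s) by rewrite mulr_gt0// subr_gt0.
  apply: cvgM.
    apply: cvgM.
      apply: powR_cvg_gt0; first by rewrite !mulr_gt0 ?pi_gt0// subr_gt0.
      apply: cvgM; first exact: cvg_cst.
      by apply: cvgB => //; exact: cvg_cst.
    apply: expR_cvg; apply: cvgN; apply: cvgM; first exact: cvg_cst.
    by apply: cvgV => //; rewrite gt_eqF.
  apply: cvg_norm; apply: cvgM.
    apply: cvgM => //; apply: powR_cvg_gt0; first by rewrite normr_gt0.
    exact: cvg_norm.
  apply: expR_cvg.
  by apply: (cvg_comp _ (fun z => z ^+ 2) uy); exact: exprn_continuous.
suff : (heat_semigroup (t - s) (fun y => `|nonlin n (u s y)|)%R x <= c)%E.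
  by rewrite leNgt cs.
apply: (@le_trans _ _ (\int[mu]_y limn_einf (F ^~ y))%E).
  apply: ae_ge0_le_integral => //.
  - move=> y _; rewrite lee_fin mulr_ge0// ltW// heat_kernel_gt0//.
    by rewrite subr_gt0.
  - apply/measurable_EFinP; apply: measurable_funM.
      exact: measurable_heat_kernel.
    by apply: measurableT_comp => //; apply: measurable_nonlin; exact: mu_.
  - by move=> y _; exact: limn_einf_ge0.
  - exact: measurable_limn_einf.
  - by apply: filterS aeF.
rewrite (le_trans (fatou _ _ _ _))//.
by apply: limn_einf_le; exact: nearW.
Unshelve. all: by end_near. Qed.

End lower_semicontinuity.

(** * A jointly measurable majorant of the Duhamel integral *)

Section duhamel_majorant.
Variables (R : realType) (n : nat).
Local Notation mu := (lebesgueRn R n).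
Local Notation leb := (@lebesgue_measure R).

(** Rounding to the grid of step 1/(k+1) takes countably many values, so a family measurable in
    space only becomes jointly measurable once its time is rounded. *)
Definition round_down (k : nat) (s : R) : R :=
  (Num.truncn (s * k.+1%:R))%:R / k.+1%:R.

Lemma round_down_cvg (s : R) : 0 <= s -> round_down k s @[k --> \oo] --> s.
Proof.
move=> s0; apply/cvgrPdist_lt => e e0; near=> k.
have /andP[lek ltk] := truncn_itv (mulr_ge0 s0 (ler0n R k.+1)).
apply: (@le_lt_trans _ _ k.+1%:R^-1); last first.
  by near: k; exact: near_infty_natSinv_lt (PosNum e0).
have k0 : (0 : R) < k.+1%:R by rewrite ltr0n.
rewrite ger0_norm ?subr_ge0 /round_down ?ler_pdivrMr//.
rewrite lerBlDr -[X in X + _]mul1r -mulrDl ler_pdivlMr//.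
by rewrite addrC natr1 ltW.
Unshelve. all: by end_near. Qed.

Lemma measurable_round_down (g : R -> Rn R n -> \bar R) (k : nat) :
  (forall s, measurable_fun setT (g s)) ->
  measurable_fun setT (fun z : measurableTypeR R * Rn R n =>
    g (round_down k z.1) z.2).
Proof.
move=> mg _ Y mY; rewrite setTI.
rewrite [X in measurable X](_ : _ = \bigcup_m
    ([set s | Num.truncn (s * k.+1%:R) = m] `*`
     (g (m%:R / k.+1%:R) @^-1` Y))).
  apply: bigcupT_measurable => m; apply: measurableX.
    have mlt (a : R) : measurable [set s : measurableTypeR R | s * k.+1%:R < a].
      rewrite [X in measurable X](_ : _ = `]-oo, (a / k.+1%:R)[%classic).
        exact: measurable_itv.
      by apply/seteqP; split => s /=; rewrite in_itv/= ltr_pdivlMr// ltr0n.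
    (* For m = 0 nothing is removed, since negative numbers are truncated to 0. *)
    rewrite [X in measurable X](_ : _ = [set s | s * k.+1%:R < m.+1%:R] `\`
        (if m is m'.+1 then [set s | s * k.+1%:R < m'.+1%:R] else set0)).
      apply: measurableD; first exact: mlt.
      by case: m => [|m]; [exact: measurable0|exact: mlt].
    apply/seteqP; split => [s /= sm|s /=].
      split; first by rewrite -truncn_le_nat sm.
      case: m sm => [|m] sm; first by [].
      move=> h; suff : (Num.truncn (s * k.+1%:R) <= m)%N by rewrite sm ltnn.
      by rewrite truncn_le_nat; exact: h.
    move=> [sm1 sm]; apply/eqP; rewrite eqn_leq truncn_le_nat sm1/=.
    case: m sm {sm1} => // m sm; rewrite ltnNge; apply/negP => h; apply: sm.
    by rewrite truncn_le_nat in h.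
  by rewrite -[X in measurable X]setTI; exact: mg.
apply/seteqP; split => [[s x] /= sx|[s x] [m _ [/= <-]]//].
by exists (Num.truncn (s * k.+1%:R)).
Qed.

Variables (u : R -> Rn R n -> R) (t p : R) (b : R -> R) (W : R).
Hypothesis mu_ : forall s, 0 < s -> measurable_fun setT (u s).
Hypothesis cu : continuous_expL2 u.
Hypothesis t0 : 0 < t.
Hypothesis p1 : 1 <= p.

Let p0 : 0 < p. Proof. exact: lt_le_trans p1. Qed.

Definition source (s : R) (x : Rn R n) : \bar R :=
  heat_semigroup (t - s) (fun y => `|nonlin n (u s y)|) x.

(** Extended by 0 because the rounded time may fall outside ]0, t[, in particular at 0. *)
Let src (s : R) (x : Rn R n) : \bar R :=
  if 0 < s < t then source s x else 0%E.

Lemma source_ge0 s x : s < t -> (0 <= source s x)%E.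
Proof. by move=> st; apply: heat_semigroup_ge0 => //; rewrite subr_gt0. Qed.

Let src_ge0 s x : (0 <= src s x)%E.
Proof. by rewrite /src; case: ifPn => // /andP[_]; exact: source_ge0. Qed.

Let measurable_src s : measurable_fun setT (src s).
Proof.
rewrite [X in measurable_fun _ X](_ : _ =
  if 0 < s < t then source s else cst 0%E); last first.
  by apply/funext => x; rewrite /src; case: ifPn.
case: ifPn => // /andP[s0 st].
apply: measurable_heat_semigroup; rewrite ?subr_gt0//.
by apply: measurableT_comp => //; apply: measurable_nonlin; exact: mu_.
Qed.

(* The source is only known to be lower semicontinuous in time, hence maybe not
   jointly measurable. The liminf of its values at the rounded-down times is
   jointly measurable, dominates it, and obeys the same L^p bounds by Fatou.
   The p-th power is inside the liminf so that no continuity of the power is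
   needed. *)
Let Hp (z : measurableTypeR R * Rn R n) : \bar R :=
  (limn_einf (fun k => src (round_down k z.1) z.2 `^ p))%E.

Let H (z : measurableTypeR R * Rn R n) : \bar R :=
  if 0 < z.1 < t then (Hp z `^ p^-1)%E else 0%E.

Let Hp_ge0 z : (0 <= Hp z)%E.
Proof. by apply: limn_einf_ge0 => k; exact: poweR_ge0. Qed.

Let measurable_Hp : measurable_fun setT Hp.
Proof.
apply: (@measurable_limn_einf _ _ _
  (fun k z => src (round_down k z.1) z.2 `^ p)%E) => k.
apply: (measurableT_comp (measurable_poweR _)).
exact: measurable_round_down.
Qed.

Let measurable_H : measurable_fun setT H.
Proof.
apply: measurable_fun_ifT => //; last first.
  exact: (measurableT_comp (measurable_poweR _)).
apply: measurable_and.
  by apply: measurable_fun_ltr => //; exact: measurable_fst.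
by apply: measurable_fun_ltr => //; exact: measurable_fst.
Qed.

(** Any c with 0 <= c < source^p satisfies c^(1/p) < source, an inequality that lower semicontinuity
    carries to nearby times and hence to the rounded ones. So the lower limit is at least c. *)
Let source_le_H s x : 0 < s -> s < t -> (source s x <= H (s, x))%E.
Proof.
move=> s0 st; rewrite /H/= s0 st/=.
have h0 := source_ge0 x st.
suff : (source s x `^ p <= Hp (s, x))%E.
  move=> /(@lee_poweR _ p^-1); rewrite -poweRrM mulfV ?gt_eqF// poweRe1//.
  by apply; rewrite ?invr_ge0 ?(ltW p0)// poweR_ge0.
apply: le_limn_einf => c ch.
have [c0|c0] := ltP c 0%E.
  by apply: nearW => k; rewrite (le_trans (ltW c0))// poweR_ge0.
have cfin : c \is a fin_num.
  by rewrite ge0_fin_numE// (lt_le_trans ch)// leey.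
have cp : (c `^ p^-1 < source s x)%E.
  rewrite ltNge; apply/negP => /(lee_poweR (ltW p0) h0).
  rewrite -poweRrM mulVf ?gt_eqF// poweRe1//.
  by rewrite leNgt ch.
have nr := round_down_cvg (ltW s0).
have := heat_semigroup_lsc mu_ cu s0 st cp.
move=> /nr cr; have rst := nr _ (lt_nbhsl st); have rs0 := nr _ (lt_nbhsr s0).
near=> k => /=.
rewrite -(poweRe1 c0) -[1]/1%R -(@mulVf _ p) ?gt_eqF// poweRrM.
apply: lee_poweR; [exact: ltW|exact: poweR_ge0|].
rewrite /src ifT; first by apply/ltW; near: k; exact: cr.
by apply/andP; split; near: k; [exact: rs0|exact: rst].
Unshelve. all: by end_near. Qed.

Let integral_H s :
  (\forall s' \near s, (\int[mu]_x source s' x `^ p <= (b s `^ p)%:E)%E) ->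
  0 < s -> s < t -> (\int[mu]_x H (s, x) `^ p <= (b s `^ p)%:E)%E.
Proof.
move=> sb s0 st; rewrite /H /= s0 st/=.
under eq_integral do rewrite -poweRrM mulVf ?gt_eqF// poweRe1//.
rewrite /Hp/= (le_trans (fatou _ _ _ _))//.
- move=> k; apply: (measurableT_comp (measurable_poweR _)) => //.
- by move=> k x _; exact: poweR_ge0.
have nr := round_down_cvg (ltW s0).
have rsb := nr _ sb; have rst := nr _ (lt_nbhsl st).
have rs0 := nr _ (lt_nbhsr s0).
apply: limn_einf_le; near=> k.
have rk : 0 < round_down k s < t.
  by apply/andP; split; near: k; [exact: rs0|exact: rst].
under eq_integral do rewrite /src rk.
by near: k; exact: rsb.
Unshelve. all: by end_near. Qed.

(** The bound b(s) is required at all times near s, because the majorant at s is built from the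
    source at the roundings of s. *)
Lemma duhamel_majorant :
  measurable_fun setT b -> (forall s, 0 < b s) ->
  (forall s, 0 < s -> s < t -> \forall s' \near s,
    (\int[mu]_x source s' x `^ p <= (b s `^ p)%:E)%E) ->
  0 < W -> (\int[leb]_(s in `]0%R, t[) (b s)%:E <= W%:E)%E ->
  exists V : Rn R n -> \bar R, [/\ measurable_fun setT V,
    forall x, (0 <= V x)%E,
    forall x, (\int[leb]_(s in `]0%R, t[) source s x <= V x)%E &
    (\int[mu]_x V x `^ p <= (W `^ p)%:E)%E].
Proof.
move=> mb b0 sb W0 bW.
have H0 z : (0 <= H z)%E.
  by rewrite /H; case: ifPn => // _; exact: poweR_ge0.
exists (fun x => \int[leb]_s H (s, x))%E; split.
- exact: (measurable_fun_fubini_tonelli_G _ measurable_H H0).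
- by move=> x; apply: integral_ge0 => s _; exact: H0.
- move=> x; rewrite integral_mkcond; apply: ge0_le_integral_nomeas => s _.
    exact: H0.
  rewrite patchE; case: ifPn => [|_]; last exact: H0.
  by rewrite inE/= in_itv/= => /andP[s0 st]; exact: source_le_H.
- apply: (@integral_minkowski _ _ _ _ _ leb mu H `]0, t[%classic b) => //.
  + by move=> s x /= /negP; rewrite in_itv/= /H/= => /negbTE ->.
  + move=> s /=; rewrite in_itv/= => /andP[s0 st].
    by apply: integral_H => //; exact: sb.
Qed.

End duhamel_majorant.

(** * Explicit time integrals *)

Section time_integrals.
Variable R : realType.
Local Notation leb := (@lebesgue_measure R).

Lemma is_derive_affine_powR (a sg c s : R) : 0 < sg * s + c ->
  is_derive s 1 (fun s => (sg * s + c) `^ a) (a * (sg * s + c) `^ (a - 1) * sg).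
Proof.
move=> sc0.
have d1 : is_derive s (1 : R) (sg *: (@id R) + cst c) sg.
  by apply: is_derive_eq; rewrite addr0 /GRing.scale/= mulr1.
have d2 := @is_derive1_powR R a (sg * s + c) sc0.
have := @is_derive1_comp R _ _ s _ _ d2 d1; apply.
Qed.

(** The sign [sg] lets one formula serve the decay in s ([sg = 1]) and the singularity at s = t
    ([sg = -1]). *)
Lemma integral_affine_powR (a sg c x y : R) : x < y -> a != 0 -> sg != 0 ->
  (forall s, x <= s <= y -> 0 < sg * s + c) ->
  (\int[leb]_(s in `[x, y]) ((sg * s + c) `^ (a - 1))%:E =
   (((sg * y + c) `^ a - (sg * x + c) `^ a) / (sg * a))%:E)%E.
Proof.
move=> xy a0 sg0 pos.
pose F : R -> R := (sg * a)^-1 *: (fun s => (sg * s + c) `^ a).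
have dF s : x <= s <= y -> is_derive s (1:R) F ((sg * s + c) `^ (a - 1)).
  move=> /pos/(is_derive_affine_powR a) h.
  apply: is_derive_eq; rewrite /GRing.scale/=; field; exact/andP.
have cF s : x <= s <= y -> {for s, continuous F}.
  move=> /dF [+ _] => h.
  exact/differentiable_continuous/derivable1_diffP.
rewrite (@continuous_FTC2 _ _ F)//.
- by rewrite -EFinB /F /GRing.scale/= -mulrBr mulrC.
- apply: continuous_in_subspaceT => s; rewrite inE/= in_itv/= => /pos sc0.
  have [+ _] := is_derive_affine_powR (a - 1) sc0.
  by move=> h; exact/differentiable_continuous/derivable1_diffP.
- split.
  + move=> s; rewrite in_itv/= => /andP[xs sy].
    by have [] := dF s; rewrite ?(ltW xs) ?(ltW sy).
  + by apply: cvg_at_right_filter; apply: cF; rewrite lexx ltW.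
  + by apply: cvg_at_left_filter; apply: cF; rewrite lexx ltW.
- move=> s; rewrite in_itv/= => /andP[xs sy].
  rewrite derive1E; have xsy : x <= s <= y by rewrite (ltW xs) (ltW sy).
  by have [] := dF s xsy.
Qed.

(** The bound is the integral of s^(-al) over ]c, +oo[, hence uniform in t. *)
Lemma integral_shift_powR_le (al c t : R) : 1 < al -> 0 < c -> 0 < t ->
  (\int[leb]_(s in `]0%R, t[) ((s + c) `^ (- al))%:E <=
    (c `^ (1 - al) / (al - 1))%:E)%E.
Proof.
move=> al1 c0 t0.
have mf : measurable_fun setT (fun s : measurableTypeR R => ((s + c) `^ (- al))%:E).
  apply/measurable_EFinP; apply: measurable_fun_powR.
  exact: measurable_funD.
apply: (@le_trans _ _ (\int[leb]_(s in `[0%R, t]) ((s + c) `^ (- al))%:E)%E).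
  apply: ge0_subset_integral => //.
  - exact: measurable_funTS.
  - by move=> s _; rewrite lee_fin powR_ge0.
  - by apply: subset_itv; rewrite bnd_simp.
under eq_integral do
  rewrite -[X in X + c]mul1r -[X in _ `^ X](addKr 1) [- 1 + _]addrC.
rewrite integral_affine_powR//; last 2 first.
- by rewrite subr_eq0 eq_sym gt_eqF.
- by move=> s /andP[s0 _]; rewrite mul1r ltr_wpDl.
rewrite lee_fin !mul1r add0r.
have -> : ((t + c) `^ (1 - al) - c `^ (1 - al)) / (1 - al) =
    (c `^ (1 - al) - (t + c) `^ (1 - al)) / (al - 1).
  have h1 : al - 1 != 0 by rewrite subr_eq0 gt_eqF.
  have h2 : 1 - al != 0 by rewrite subr_eq0 lt_eqF.
  by field; rewrite h1 h2.
rewrite ler_wpM2r ?invr_ge0 ?subr_ge0 ?(ltW al1)//.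
by rewrite gerBl powR_ge0.
Qed.

Lemma powR_half_subadd (a b : R) : 0 <= a -> 0 <= b ->
  (a + b) `^ 2^-1 <= a `^ 2^-1 + b `^ 2^-1.
Proof.
move=> a0 b0; rewrite !powR12_sqrt ?addr_ge0//.
rewrite -(@ler_pXn2r _ 2)// ?nnegrE ?addr_ge0 ?sqrtr_ge0//.
rewrite sqr_sqrtr ?addr_ge0// sqrrD !sqr_sqrtr// lerD2r lerDl.
by rewrite mulrn_wge0// mulr_ge0// sqrtr_ge0.
Qed.

Lemma integral_sqrt_sing_le (T t : R) : T < t ->
  (\int[leb]_(s in `]T, t[) ((t - s) `^ (- 2^-1))%:E <=
    (2 * (t - T) `^ 2^-1)%:E)%E.
Proof.
(* Regularise the singularity at [t] by 1/(k+1), and conclude by Fatou. *)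
move=> Tt; pose h k (s : measurableTypeR R) : \bar R :=
  ((t - s + k.+1%:R^-1) `^ (- 2^-1))%:E.
have mh k : measurable_fun setT (h k).
  apply/measurable_EFinP; apply: measurable_fun_powR.
  by apply: measurable_funD => //; exact: measurable_funB.
have h0 k s : (0 <= h k s)%E by rewrite lee_fin powR_ge0.
have d0 k : (0 : R) < k.+1%:R^-1 by rewrite invr_gt0 ltr0n.
apply: (@le_trans _ _ (\int[leb]_(s in `]T, t[) limn_einf (h ^~ s))%E).
  apply: ge0_le_integral_nomeas => s; first by move=> _; exact: limn_einf_ge0.
  rewrite /= in_itv/= => /andP[Ts st].
  rewrite (@cvg_limn_einf_sup _ _ ((t - s) `^ (- 2^-1))%:E)//.
  apply: cvg_EFin; first exact: nearW.
  apply: powR_cvg_gt0; first by rewrite subr_gt0.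
  rewrite -[X in _ --> X]addr0; apply: cvgD; first exact: cvg_cst.
  exact: cvg_harmonic.
rewrite (le_trans (fatou _ _ _ _))//.
  by move=> k; exact: measurable_funTS.
apply: limn_einf_le; apply: nearW => k.
apply: (@le_trans _ _ (\int[leb]_(s in `[T, t]) h k s)%E).
  apply: ge0_subset_integral => //; first exact: measurable_funTS.
  by apply: subset_itv; rewrite bnd_simp.
rewrite /h (_ : (- 2^-1 = 2^-1 - 1)); last by field.
have E s : t - s + k.+1%:R^-1 = - 1 * s + (t + k.+1%:R^-1) by ring.
under eq_integral do rewrite E.
rewrite integral_affine_powR//; last first.
  move=> s /andP[_ st]; rewrite -E ltr_wpDl// subr_ge0//.
rewrite lee_fin -!E subrr add0r.
have := powR_half_subadd (_ : 0 <= t - T) (ltW (d0 k)).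
rewrite subr_ge0 (ltW Tt) => /(_ isT) H.
have -> : (- 1 * 2^-1)^-1 = - 2 :> R by field.
rewrite mulrN -mulNr opprB mulrC ler_pM2l//; lra.
Qed.

End time_integrals.

(** * The source under the decay bounds *)

Section step.
Variables (R : realType) (n : nat) (u : R -> Rn R n -> R) (p : R).
Hypothesis n0 : (0 < n)%N.
Hypothesis mu_ : forall s, 0 < s -> measurable_fun setT (u s).
Hypothesis cu : continuous_expL2 u.
Hypothesis p1 : 1 <= p.
Local Notation mu := (lebesgueRn R n).
Local Notation leb := (@lebesgue_measure R).
Local Notation beta := (n%:R / (2 * p)).
Local Notation alpha := (2 / p).

Let p0 : 0 < p. Proof. exact: lt_le_trans p1. Qed.
Let n0R : (0 : R) < n%:R. Proof. by rewrite ltr0n. Qed.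

Definition bounded_at (D s : R) : Prop :=
  (\int[mu]_x (`|u s x| `^ p)%:E <= (D `^ p)%:E)%E /\
  {ae mu, forall x, `|u s x| <= D * s `^ (- beta)}.

(* [|f v| <= growth D s^(-2/p) |v|] whenever [|v| <= D s^(-n/(2p))], [1 <= s]. *)
Definition growth (D : R) : R := D `^ (4 / n%:R) * expR (D ^+ 2).

Lemma growth_ge0 D : 0 <= growth D.
Proof. by rewrite mulr_ge0 ?powR_ge0 ?expR_ge0. Qed.

(** The factor |u|^(4/n) decays like s^(-2/p) because n/(2p) times 4/n is 2/p; for s >= 1 one has
    |u| <= D, which bounds the exponential. *)
Lemma nonlin_le_of_bounded (D s : R) : 0 <= D -> 1 <= s -> bounded_at D s ->
  {ae mu, forall x, `|nonlin n (u s x)| <=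
    growth D * s `^ (- alpha) * `|u s x|}.
Proof.
move=> D0 s1 [_]; apply: filterS => x; set v := `|u s x| => vB.
have s0 : 0 < s by rewrite (lt_le_trans _ s1).
have sb1 : s `^ (- beta) <= 1.
  rewrite powRN invf_le1 ?powR_gt0// -[X in X <= _](powRr0 s); apply: ler_powR => //.
  by rewrite divr_ge0// mulr_ge0// ltW.
rewrite /nonlin 2!normrM (ger0_norm (powR_ge0 _ _)) (ger0_norm (expR_ge0 _)).
have v0 : 0 <= v by exact: normr_ge0.
rewrite -/v mulrAC ler_wpM2r//.
rewrite /growth mulrAC ler_pM ?powR_ge0 ?expR_ge0//.
  have -> : - alpha = - beta * (4 / n%:R) by field; rewrite !gt_eqF.
  rewrite [s `^ _]powRrM -powRM ?powR_ge0// ge0_ler_powR ?nnegrE ?mulr_ge0 ?powR_ge0//.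
have vD : v <= D by rewrite (le_trans vB)// ler_piMr.
by rewrite ler_expR -[u s x ^+ 2]real_normK ?num_real// ler_pXn2r ?nnegrE.
Qed.

Variable t : R.
Hypothesis t0 : 0 < t.

Lemma source_bounded (D s : R) : 0 <= D -> 1 <= s -> s < t -> bounded_at D s ->
  (\int[mu]_x source u t s x `^ p <=
    ((growth D * s `^ (- alpha) * D) `^ p)%:E)%E /\
  forall x, (source u t s x <=
    ((t / 2) `^ (- beta) * (growth D * s `^ (- alpha) * D))%:E)%E.
Proof.
move=> D0 s1 st bD; have s0 : 0 < s by rewrite (lt_le_trans _ s1).
have [bp bi] := bD.
set q := growth D * s `^ (- alpha).
have q0 : 0 <= q by rewrite mulr_ge0 ?growth_ge0 ?powR_ge0.
have ts0 : 0 < t - s by rewrite subr_gt0.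
have mf : measurable_fun setT (fun y => `|nonlin n (u s y)|).
  by apply: measurableT_comp => //; apply: measurable_nonlin; exact: mu_.
have mus := mu_ s0.
have fq := nonlin_le_of_bounded D0 s1 bD.
have fp : (\int[mu]_y (`|nonlin n (u s y)| `^ p)%:E <= ((q * D) `^ p)%:E)%E.
  apply: (@le_trans _ _
      (\int[mu]_x ((q `^ p)%:E * (`|u s x| `^ p)%:E))%E).
    apply: ae_ge0_le_integral => //.
    - by apply/measurable_EFinP; exact: measurable_fun_powR.
    - by move=> x _; rewrite mule_ge0// lee_fin powR_ge0.
    - apply: measurable_funeM; apply/measurable_EFinP.
      by apply: measurable_fun_powR; exact: measurableT_comp.
    - apply: filterS fq => x fx _; rewrite -EFinM lee_fin -powRM//.
      by apply: ge0_ler_powR; rewrite ?nnegrE ?(ltW p0) ?(mulr_ge0 q0).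
  rewrite ge0_integralZl//; last 2 first.
  - apply/measurable_EFinP; apply: measurable_fun_powR.
    exact: measurableT_comp.
  - by rewrite lee_fin powR_ge0.
  by rewrite powRM// EFinM lee_wpmul2l// lee_fin powR_ge0.
split.
  by rewrite (le_trans (heat_semigroup_contract ts0 mf _ p1)).
move=> x; have qD0 : 0 <= q * D by rewrite mulr_ge0.
have b0 : 0 <= beta by rewrite divr_ge0// mulr_ge0// ltW.
have th0 : 0 < t / 2 by rewrite divr_gt0.
have mono y : t / 2 <= y -> y `^ (- beta) <= (t / 2) `^ (- beta).
  move=> ty; rewrite !powRN lef_pV2 ?posrE ?powR_gt0 ?(lt_le_trans th0)//.
  by apply: ge0_ler_powR; rewrite // nnegrE ltW// (lt_le_trans th0).
(* For s <= t/2 the rate (t/2)^(-beta) comes from smoothing over the time t - s >= t/2; for s > t/2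
   it comes from the decay of [u s] in L^oo, which the semigroup preserves. *)
have [s2|s2] := leP s (t / 2).
  rewrite (le_trans (heat_semigroup_le_sup x ts0 mf _ p1 qD0 fp))//.
  rewrite lee_fin ler_wpM2r// mono//; lra.
apply: heat_semigroup_le_cst => //.
  apply: filterS2 fq bi => y fy uy; rewrite (le_trans fy)//.
  rewrite -/q [leRHS]mulrCA ler_wpM2l//.
  by rewrite (le_trans uy)// mulrC ler_wpM2r// mono// ltW.
by rewrite mulr_ge0 ?powR_ge0.
Qed.

End step.

(** * Integrals of the pieces of the time majorant *)

Section step_integrals.
Variable R : realType.
Local Notation leb := (@lebesgue_measure R).
Implicit Types t c k T : R.

Lemma integral_cst_before_le t c k : 0 <= c -> 0 <= k ->
  (\int[leb]_(s in `]0%R, t[) (k * \1_(`]-oo, c]%classic : set R) s)%:E <=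
    (k * c)%:E)%E.
Proof.
move=> c0 k0; under eq_integral do rewrite EFinM.
rewrite ge0_integralZl//; last by apply/measurable_EFinP; exact: measurable_indic.
rewrite integral_indic//= EFinM lee_wpmul2l//.
apply: (@le_trans _ _ (leb `[0%R, c]%classic)).
  apply: le_measure; rewrite ?inE//; first exact: measurableI.
  by move=> s /=; rewrite !in_itv/= => -[-> /andP[/ltW -> _]].
by rewrite lebesgue_measure_itv/= lte_fin; case: ifPn; rewrite ?sube0 ?lee_fin// EFinN oppe0 adde0.
Qed.

Lemma integral_cst_after_le t T k : T <= t -> 0 <= k ->
  (\int[leb]_(s in `]0%R, t[) (k * \1_(`[T, +oo[%classic : set R) s)%:E <=
    (k * (t - T))%:E)%E.
Proof.
move=> Tt k0; under eq_integral do rewrite EFinM.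
rewrite ge0_integralZl//; last by apply/measurable_EFinP; exact: measurable_indic.
rewrite integral_indic//= EFinM lee_wpmul2l//.
apply: (@le_trans _ _ (leb `[T, t]%classic)).
  apply: le_measure; rewrite ?inE//; first exact: measurableI.
  by move=> s /=; rewrite !in_itv/= andbT => -[-> /andP[_ /ltW ->]].
rewrite lebesgue_measure_itv/= lte_fin; case: ifPn => //.
by rewrite lee_fin subr_ge0.
Qed.

Lemma measurable_sing t :
  measurable_fun setT (fun s : measurableTypeR R => (t - s) `^ (- 2^-1)).
Proof. by apply: measurable_fun_powR; exact: measurable_funB. Qed.

Lemma integral_sing_after_le t T k : T <= t -> 0 <= k ->
  (\int[leb]_(s in `]0%R, t[)
      (k * (t - s) `^ (- 2^-1) * \1_(`[T, +oo[%classic : set R) s)%:E <=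
    (k * (2 * (t - T) `^ 2^-1))%:E)%E.
Proof.
move=> Tt k0; under eq_integral do rewrite -mulrA EFinM.
have mg : measurable_fun setT
    (fun s : measurableTypeR R => ((t - s) `^ (- 2^-1))%:E).
  by apply/measurable_EFinP; exact: measurable_sing.
have mh : measurable_fun setT (fun s : measurableTypeR R =>
    ((t - s) `^ (- 2^-1) * \1_(`[T, +oo[%classic : set R) s)%:E).
  apply/measurable_EFinP; apply: measurable_funM; first exact: measurable_sing.
  exact: measurable_indic.
rewrite ge0_integralZl//; last 2 first.
- exact: measurable_funTS.
- by move=> s _; rewrite lee_fin mulr_ge0 ?powR_ge0.
rewrite EFinM lee_wpmul2l//.
apply: (@le_trans _ _
    (\int[leb]_(s in `[T, t[) ((t - s) `^ (- 2^-1))%:E)%E).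
  rewrite [leLHS]integral_mkcond [leRHS]integral_mkcond.
  apply: ge0_le_integral_nomeas => s _; rewrite !patchE.
    by case: ifPn => // _; rewrite lee_fin powR_ge0.
  rewrite indicE; case: ifPn => [|_]; last first.
    by case: ifPn => // _; rewrite lee_fin powR_ge0.
  rewrite inE/= in_itv/= => /andP[_ st].
  have -> : (s \in `[T, t[%classic) = (s \in `[T, +oo[%classic).
    by apply/idP/idP; rewrite !inE/= !in_itv/= st ?andbT.
  by case: ifPn => _; rewrite ?mulr1 ?mulr0.
move: Tt; rewrite le_eqVlt => /predU1P[<-|Tt].
  by rewrite set_itvco0// integral_set0 lee_fin mulr_ge0// powR_ge0.
rewrite -integral_itv_obnd_cbnd; last exact: measurable_funTS.
exact: integral_sqrt_sing_le.
Qed.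

Lemma ge0_integral_add3_le t (f g h : R -> R) (M1 M2 M3 : R) :
  measurable_fun setT (f : measurableTypeR R -> R) ->
  measurable_fun setT (g : measurableTypeR R -> R) ->
  measurable_fun setT (h : measurableTypeR R -> R) ->
  (forall s, 0 <= f s) -> (forall s, 0 <= g s) -> (forall s, 0 <= h s) ->
  (\int[leb]_(s in `]0%R, t[) (f s)%:E <= M1%:E)%E ->
  (\int[leb]_(s in `]0%R, t[) (g s)%:E <= M2%:E)%E ->
  (\int[leb]_(s in `]0%R, t[) (h s)%:E <= M3%:E)%E ->
  (\int[leb]_(s in `]0%R, t[) (f s + g s + h s)%:E <= (M1 + M2 + M3)%:E)%E.
Proof.
move=> mf mg mh f0 g0 h0 fM gM hM.
under eq_integral do rewrite !EFinD.
rewrite ge0_integralD//=; last 4 first.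
- by move=> s _; rewrite -EFinD lee_fin addr_ge0.
- apply: measurable_funTS; apply: emeasurable_funD; exact/measurable_EFinP.
- by move=> s _; rewrite lee_fin.
- by apply: measurable_funTS; exact/measurable_EFinP.
rewrite ge0_integralD//=; last 4 first.
- by move=> s _; rewrite lee_fin.
- by apply: measurable_funTS; exact/measurable_EFinP.
- by move=> s _; rewrite lee_fin.
- by apply: measurable_funTS; exact/measurable_EFinP.
by rewrite !EFinD !leeD.
Qed.

End step_integrals.

(** * Estimate of the Duhamel integral *)

Section duhamel_step.
Variables (R : realType) (n : nat) (u : R -> Rn R n -> R) (p : R).
Hypothesis n0 : (0 < n)%N.
Hypothesis mu_ : forall s, 0 < s -> measurable_fun setT (u s).
Hypothesis cu : continuous_expL2 u.
Hypothesis p1 : 1 <= p.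
Hypothesis p2 : p < 2.
Local Notation mu := (lebesgueRn R n).
Local Notation leb := (@lebesgue_measure R).
Local Notation beta := (n%:R / (2 * p)).
Local Notation alpha := (2 / p).

Let p0 : 0 < p. Proof. exact: lt_le_trans p1. Qed.
Let alpha1 : 1 < alpha. Proof. by rewrite ltr_pdivlMr// mul1r. Qed.

(* [growth D * D] times the integral of [s^(-2/p)] over [tc, +oo[, which
   converges as p < 2, up to the factor 2^(2/p + 1) that makes room for
   replacing s by s + tc and by nearby times. *)
Definition tail (D tc : R) : R :=
  2 `^ (alpha + 1) * growth n D * D * (tc `^ (1 - alpha) / (alpha - 1)).

(* The time integral is cut at [tc] and [T]. Before [tc] the source is controlled
   by constants, between [tc] and [T] by the decay of [u], and after [T] by the
   local-in-time bounds coming from the exp L^2 norm alone. *)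
Lemma duhamel_step (t tc T D a a' kp kn : R) :
  0 < t -> 1 <= tc -> 0 <= T -> T <= t -> 0 < D ->
  0 <= a -> 0 <= a' -> 0 <= kp -> 0 <= kn ->
  (forall s, 0 < s -> s < t -> s < 2 * tc ->
    (\int[mu]_x source u t s x `^ p <= (a `^ p)%:E)%E) ->
  (forall s x, 0 < s -> s < T -> s <= tc -> s < t ->
    (source u t s x <= a'%:E)%E) ->
  (forall s, 0 < s -> s < t ->
    (\int[mu]_x source u t s x `^ p <= (kp `^ p)%:E)%E) ->
  (forall s x, T <= s -> 0 < s -> s < t ->
    (source u t s x <= (kn * (t - s) `^ (- 2^-1))%:E)%E) ->
  (forall s, tc < s -> s < T -> bounded_at u p D s) ->
  (exists V : Rn R n -> \bar R, [/\ measurable_fun setT V,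
    forall x, (0 <= V x)%E,
    forall x, (\int[leb]_(s in `]0%R, t[) source u t s x <= V x)%E &
    (\int[mu]_x V x `^ p <=
      ((a * tc + kp * (t - T) + tail D tc) `^ p)%:E)%E]) /\
  forall x, (\int[leb]_(s in `]0%R, t[) source u t s x <=
    (a' * tc + (t / 2) `^ (- beta) * tail D tc +
      kn * (2 * (t - T) `^ 2^-1))%:E)%E.
Proof.
move=> t0 tc1 T0 Tt D0 a0 a'0 kp0 kn0 Ha Ha' Hkp Hkn HD.
have tc0 : 0 < tc by rewrite (lt_le_trans _ tc1).
pose A := 2 `^ (alpha + 1) * growth n D * D.
have gD : 0 < growth n D by rewrite /growth mulr_gt0 ?powR_gt0 ?expR_gt0.
have A0 : 0 < A by rewrite mulr_gt0// mulr_gt0// powR_gt0.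
have tail0 : 0 < tail D tc.
  by rewrite /tail -/A mulr_gt0// divr_gt0 ?powR_gt0// subr_gt0.
have [c [c0 mc Ic cs]] : exists c : R -> R, [/\ forall s, 0 < c s,
    measurable_fun setT (c : measurableTypeR R -> R),
    (\int[leb]_(s in `]0%R, t[) (c s)%:E <= (tail D tc)%:E)%E &
    forall s, tc < s -> 2 * (growth n D * s `^ (- alpha) * D) <= c s].
  (* The shift by [tc] and the absolute value keep [c] positive on the whole line, as a majorant
     must be. Past [tc] one has s + tc <= 2 s, which costs 2^alpha; the other factor 2 leaves room
     for nearby times. *)
  pose c (s : R) := A * (`|s| + tc) `^ (- alpha).
  have c0 s : 0 < c s by rewrite mulr_gt0// powR_gt0// ltr_wpDl.
  have mc : measurable_fun setT (c : measurableTypeR R -> R).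
    apply: measurable_funM => //; apply: measurable_fun_powR.
    by apply: measurable_funD => //; exact: measurableT_comp.
  have Ic : (\int[leb]_(s in `]0%R, t[) (c s)%:E <= (tail D tc)%:E)%E.
    under eq_integral => s.
      rewrite inE/= in_itv/= => /andP[s0 _]; rewrite /c gtr0_norm// EFinM; over.
    rewrite ge0_integralZl//; last 3 first.
    - apply/measurable_EFinP; apply: measurable_fun_powR.
      by apply: measurable_funTS; exact: measurable_funD.
    - by move=> s _; rewrite lee_fin powR_ge0.
    - by rewrite lee_fin ltW.
    by rewrite /tail -/A [leRHS]EFinM lee_wpmul2l ?lee_fin ?(ltW A0)// integral_shift_powR_le.
  have cs s : tc < s -> 2 * (growth n D * s `^ (- alpha) * D) <= c s.
    move=> ts; have s0 : 0 < s by rewrite (lt_trans _ ts).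
    rewrite /c gtr0_norm// /A.
    have h : s `^ (- alpha) <= 2 `^ alpha * (s + tc) `^ (- alpha).
      rewrite !powRN -ler_pdivrMl ?powR_gt0//.
      rewrite -invfM lef_pV2 ?posrE ?mulr_gt0 ?powR_gt0 ?addr_gt0//.
      rewrite -powRM ?(ltW s0)//; apply: ge0_ler_powR.
      - by rewrite ltW// (lt_trans _ alpha1).
      - by rewrite nnegrE addr_ge0 ?ltW.
      - by rewrite nnegrE mulr_ge0// ltW.
      - lra.
    have -> : 2 `^ (alpha + 1) = 2 * 2 `^ alpha :> R.
      by rewrite powRD ?powRr1 1?mulrC// pnatr_eq0 implybT.
    have -> : 2 * (growth n D * s `^ (- alpha) * D) =
      2 * growth n D * D * s `^ (- alpha) by ring.
    have -> : 2 * 2 `^ alpha * growth n D * D * (s + tc) `^ (- alpha) =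
      2 * growth n D * D * (2 `^ alpha * (s + tc) `^ (- alpha)) by ring.
    by apply: ler_wpM2l h; rewrite mulr_ge0 ?(ltW D0)// mulr_ge0// (ltW gD).
  by exists c.
have sb s : tc < s -> s < T ->
    (\int[mu]_x source u t s x `^ p <=
      ((growth n D * s `^ (- alpha) * D) `^ p)%:E)%E /\
    forall x, (source u t s x <=
      ((t / 2) `^ (- beta) * (growth n D * s `^ (- alpha) * D))%:E)%E.
  move=> ts sT; apply: source_bounded => //; last exact: HD.
  - exact: ltW.
  - by rewrite (le_trans tc1)// ltW.
  - exact: lt_le_trans Tt.
split; last first.
  move=> x.
  pose B s := a' * \1_(`]-oo, tc]%classic : set R) s +
    (t / 2) `^ (- beta) * c s +
    kn * (t - s) `^ (- 2^-1) * \1_(`[T, +oo[%classic : set R) s.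
  apply: (@le_trans _ _ (\int[leb]_(s in `]0%R, t[) (B s)%:E)%E).
    apply: ge0_le_integral_nomeas => s; rewrite /= in_itv/= => /andP[s0 st].
      by rewrite lee_fin !addr_ge0// ?mulr_ge0 ?powR_ge0// (ltW (c0 s)).
    have [Ts|sT] := leP T s.
      rewrite (le_trans (Hkn s x Ts s0 st))// lee_fin /B [in X in _ <= _ + X]indicE.
      rewrite mem_set ?mulr1; last by rewrite /= in_itv/= Ts.
      by rewrite lerDr addr_ge0// mulr_ge0// ?powR_ge0// (ltW (c0 s)).
    have k0 : 0 <= kn * (t - s) `^ (- 2^-1) * \1_(`[T, +oo[%classic : set R) s.
      by rewrite !mulr_ge0// powR_ge0.
    have [ts|ts] := leP s tc.
      rewrite (le_trans (Ha' s x s0 sT ts st))// lee_fin /B.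
      rewrite [\1_(`]-oo, tc]%classic : set R) s]indicE mem_set; last first.
        by rewrite /= in_itv.
      by rewrite mulr1 -addrA lerDl addr_ge0// mulr_ge0 ?powR_ge0// (ltW (c0 s)).
    have [_ /(_ x)/le_trans] := sb s ts sT; apply; rewrite lee_fin /B.
    apply: (@le_trans _ _ ((t / 2) `^ (- beta) * c s)).
      rewrite ler_wpM2l ?powR_ge0// (le_trans _ (cs s ts))//.
      by rewrite ler_peMl ?ler1n// mulr_ge0 ?(ltW D0)// mulr_ge0 ?powR_ge0 ?(ltW gD).
    by rewrite addrAC lerDr addr_ge0// mulr_ge0.
  apply: ge0_integral_add3_le.
  - by apply: measurable_funM => //; exact: measurable_indic.
  - by apply: measurable_funM.
  - apply: measurable_funM; last exact: measurable_indic.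
    by apply: measurable_funM => //; exact: measurable_sing.
  - by move=> s; rewrite mulr_ge0.
  - by move=> s; rewrite mulr_ge0 ?powR_ge0// (ltW (c0 s)).
  - by move=> s; rewrite !mulr_ge0// powR_ge0.
  - exact: integral_cst_before_le (ltW tc0) a'0.
  - under eq_integral do rewrite EFinM.
    rewrite ge0_integralZl//; last 3 first.
    + by apply: measurable_funTS; exact/measurable_EFinP.
    + by move=> s _; rewrite lee_fin ltW.
    + by rewrite lee_fin powR_ge0.
    by rewrite [leRHS]EFinM lee_wpmul2l// lee_fin powR_ge0.
  - exact: integral_sing_after_le.
pose b (s : R) := a * \1_(`]-oo, tc]%classic : set R) s +
  kp * \1_(`[T, +oo[%classic : set R) s + c s.
have b0 s : 0 < b s by rewrite ltr_wpDl// addr_ge0// mulr_ge0.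
have mb : measurable_fun setT (b : measurableTypeR R -> R).
  apply: measurable_funD => //; apply: measurable_funD;
  by apply: measurable_funM => //; exact: measurable_indic.
apply: (@duhamel_majorant _ _ u t p b) => //.
- move=> s s0 st.
  have ae : a * \1_(`]-oo, tc]%classic : set R) s <= b s.
    by rewrite /b -addrA lerDl addr_ge0 ?mulr_ge0// ltW.
  have ke : kp * \1_(`[T, +oo[%classic : set R) s <= b s.
    by rewrite /b addrAC lerDr addr_ge0 ?mulr_ge0// ltW.
  have mono y z : 0 <= y -> y <= z -> ((y `^ p)%:E <= (z `^ p)%:E)%E.
    move=> y0 yz; rewrite lee_fin ge0_ler_powR ?nnegrE ?(ltW p0)//.
    exact: le_trans yz.
  (* Times near s = tc may exceed [tc], which is why the bound by [a] is assumed up to 2 tc. After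
     [T] the bound by [kp] holds at all times; in between, continuity of the power costs the factor
     2. *)
  have [ts|ts] := leP s tc.
    rewrite indicE mem_set ?mulr1 in ae; last by rewrite /= in_itv.
    near=> s'; apply: (le_trans _ (mono _ _ a0 ae)); apply: Ha; near: s'.
    + exact: lt_nbhsr.
    + exact: lt_nbhsl.
    + by apply: lt_nbhsl; rewrite (le_lt_trans ts)// ltr_pMl// ltr1n.
  have [Ts|sT] := leP T s.
    rewrite indicE mem_set ?mulr1 in ke; last by rewrite /= in_itv/= Ts.
    near=> s'; apply: (le_trans _ (mono _ _ kp0 ke)); apply: Hkp; near: s'.
    + exact: lt_nbhsr.
    + exact: lt_nbhsl.
  have cb : c s <= b s by rewrite /b lerDr addr_ge0 ?mulr_ge0.
  have s'2 : \forall s' \near s, s' `^ (- alpha) < 2 * s `^ (- alpha).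
    have : (fun s' : R => s' `^ (- alpha)) @ s --> s `^ (- alpha).
      exact: powR_cvg_gt0.
    move=> /cvgr_lt; apply.
    by rewrite ltr_pMl ?ltr1n// powR_gt0.
  near=> s'.
  have ts' : tc < s' by near: s'; exact: lt_nbhsr.
  have sT' : s' < T by near: s'; exact: lt_nbhsl.
  have [/le_trans + _] := sb s' ts' sT'; apply.
  apply: mono.
    by rewrite mulr_ge0 ?(ltW D0)// mulr_ge0 ?powR_ge0 ?(ltW gD).
  rewrite (le_trans _ cb)// (le_trans _ (cs s ts))//.
  have -> : 2 * (growth n D * s `^ (- alpha) * D) =
    growth n D * (2 * s `^ (- alpha)) * D by ring.
  rewrite ler_wpM2r ?(ltW D0)//.
  rewrite ler_wpM2l ?(ltW gD)// ltW//.
  by near: s'.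
- by rewrite ltr_wpDl// addr_ge0 ?mulr_ge0// ?subr_ge0// ltW.
apply: ge0_integral_add3_le => //.
- by apply: measurable_funM => //; exact: measurable_indic.
- by apply: measurable_funM => //; exact: measurable_indic.
- by move=> s; rewrite mulr_ge0.
- by move=> s; rewrite mulr_ge0.
- by move=> s; exact: ltW.
- exact: integral_cst_before_le (ltW tc0) a0.
- exact: integral_cst_after_le.
Unshelve. all: by end_near. Qed.

End duhamel_step.

(** * Minkowski's inequality for two functions *)

Section Lp_add.
Context d (T : measurableType d) (R : realType).
Variable mu : {measure set T -> \bar R}.

(* Convexity of the power at weights A/(A+B) and B/(A+B): integrated, it is
   Minkowski's inequality for functions of norms at most A and B. *)
Lemma powR_add_le (p A B x y : R) : 1 <= p -> 0 < A -> 0 < B ->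
  0 <= x -> 0 <= y ->
  (x + y) `^ p <= (A + B) `^ (p - 1) *
    (A `^ (1 - p) * x `^ p + B `^ (1 - p) * y `^ p).
Proof.
move=> p1 A0 B0 x0 y0; have AB0 : 0 < A + B by rewrite addr_gt0.
have p0 : 0 < p by rewrite (lt_le_trans _ p1).
have l0 : 0 <= A / (A + B) by rewrite divr_ge0 ?ltW.
have l1 : A / (A + B) <= 1 by rewrite ler_pdivrMr// mul1r lerDl ltW.
have := @convex_powR R p p1 (Itv01 l0 l1) (x * (A + B) / A) (y * (A + B) / B).
rewrite !inE/= !in_itv/= !andbT.
have x'0 : 0 <= x * (A + B) / A by rewrite divr_ge0 ?mulr_ge0 ?(ltW A0) ?(ltW AB0).
have y'0 : 0 <= y * (A + B) / B by rewrite divr_ge0 ?mulr_ge0 ?(ltW B0) ?(ltW AB0).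
move=> /(_ x'0 y'0); rewrite [X in (X `^ _ <= _) -> _]convRE [X in (_ <= X) -> _]convRE/= /unstable.onem.
have -> : 1 - A / (A + B) = B / (A + B) by field; rewrite gt_eqF.
have -> : A / (A + B) * (x * (A + B) / A) + B / (A + B) * (y * (A + B) / B) =
  x + y by field; rewrite !gt_eqF.
move=> /le_trans; apply; rewrite le_eqVlt; apply/orP; left; apply/eqP.
have E (z C : R) : 0 <= z -> 0 < C -> C / (A + B) * (z * (A + B) / C) `^ p =
    (A + B) `^ (p - 1) * (C `^ (1 - p) * z `^ p).
  move=> z0 C0.
  rewrite [(z * _ / C) `^ p]powRM ?invr_ge0 ?(ltW C0) ?(mulr_ge0 z0 (ltW AB0))//.
  rewrite [(z * _) `^ p]powRM ?(ltW AB0)//.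
  rewrite -(powR_inv1 (ltW C0)) -powRrM mulN1r.
  rewrite -[(A + B) `^ p](@mulr_powRB1 _ _ p) ?(ltW AB0)//.
  rewrite [C `^ (1 - p)]powRD; last by rewrite (gt_eqF C0) implybT.
  rewrite powRr1 ?(ltW C0)//.
  by field; rewrite gt_eqF.
by rewrite (E x A)// (E y B)// -mulrDr.
Qed.

(** [A] and [B] are upper bounds for the norms, positive because they occur with negative powers.
    Replacing both integrals by their bounds turns the weighted sum of [powR_add_le] into exactly (A
    + B)^p. *)
Lemma integral_powR_add_le (p A B : R) (g h V : T -> \bar R) :
  1 <= p -> 0 < A -> 0 < B ->
  measurable_fun setT g -> measurable_fun setT h -> measurable_fun setT V ->
  (forall x, 0 <= g x)%E -> (forall x, 0 <= h x)%E -> (forall x, 0 <= V x)%E ->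
  {ae mu, forall x, (g x <= h x + V x)%E} ->
  (\int[mu]_x h x `^ p <= (A `^ p)%:E)%E ->
  (\int[mu]_x V x `^ p <= (B `^ p)%:E)%E ->
  (\int[mu]_x g x `^ p <= ((A + B) `^ p)%:E)%E.
Proof.
move=> p1 A0 B0 mg mh mV g0 h0 V0 gle hA VB.
have AB0 : 0 < A + B by rewrite addr_gt0.
have p0 : 0 < p by rewrite (lt_le_trans _ p1).
pose k := (A + B) `^ (p - 1).
pose cA := k * A `^ (1 - p). pose cB := k * B `^ (1 - p).
have k0 : 0 < k by rewrite powR_gt0.
have cA0 : 0 < cA by rewrite mulr_gt0// powR_gt0.
have cB0 : 0 < cB by rewrite mulr_gt0// powR_gt0.
have mhp : measurable_fun setT (fun x => h x `^ p)%E.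
  exact: (measurableT_comp (measurable_poweR _)).
have mVp : measurable_fun setT (fun x => V x `^ p)%E.
  exact: (measurableT_comp (measurable_poweR _)).
apply: (@le_trans _ _
    (\int[mu]_x (cA%:E * h x `^ p + cB%:E * V x `^ p))%E).
  apply: ae_ge0_le_integral => //.
  - by move=> x _; exact: poweR_ge0.
  - exact: (measurableT_comp (measurable_poweR _)).
  - by move=> x _; rewrite adde_ge0// mule_ge0 ?poweR_ge0// lee_fin ltW.
  - by apply: emeasurable_funD; exact: measurable_funeM.
  - apply: filterS gle => x + _.
    have := h0 x; have := V0 x.
    case: (h x) => [a| |//]; last first.
      by move=> _ _ _; rewrite poweRyr ?gt_eqF// gt0_muley ?lte_fin// addye ?leey//
        gt_eqF// (lt_le_trans _ (mule_ge0 _ (poweR_ge0 _ _)))// ?ltNyr// lee_fin ltW.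
    case: (V x) => [b| |//]; last first.
      by move=> _ _ _; rewrite (poweRyr (_ : p != 0)) ?gt_eqF// gt0_muley ?lte_fin//
        poweR_EFin -EFinM addey// ?leey.
    rewrite !lee_fin => b0 a0 gab.
    apply: (le_trans (lee_poweR (ltW p0) (g0 x) gab)); rewrite lee_fin.
    rewrite (le_trans (powR_add_le p1 A0 B0 a0 b0))//.
    by rewrite mulrDr !mulrA.
rewrite ge0_integralD//; last 4 first.
- by move=> x _; rewrite mule_ge0 ?poweR_ge0// lee_fin ltW.
- exact: measurable_funeM.
- by move=> x _; rewrite mule_ge0 ?poweR_ge0// lee_fin ltW.
- exact: measurable_funeM.
rewrite !ge0_integralZl ?lee_fin ?(ltW cA0) ?(ltW cB0)//; last 2 first.
- by move=> x _; exact: poweR_ge0.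
- by move=> x _; exact: poweR_ge0.
apply: (@le_trans _ _ (cA%:E * (A `^ p)%:E + cB%:E * (B `^ p)%:E)%E).
  by apply: leeD; apply: lee_wpmul2l => //; rewrite lee_fin ltW.
rewrite -!EFinM -EFinD lee_fin /cA /cB -!mulrA -mulrDr.
have E (C : R) : 0 < C -> C `^ (1 - p) * C `^ p = C.
  move=> C0; rewrite -powRD ?(gt_eqF C0) ?implybT// subrK.
  by rewrite powRr1 ?(ltW C0).
by rewrite !E// /k mulrC mulr_powRB1// ltW.
Qed.

End Lp_add.

(** * From the Duhamel formula to bounds on the solution *)

Section duhamel_combine.
Variables (R : realType) (n : nat) (phi : Rn R n -> R) (u : R -> Rn R n -> R).
Local Notation mu := (lebesgueRn R n).
Local Notation leb := (@lebesgue_measure R).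

(** Positivity turns |u t| into u t, to which the formula applies; then only its right-hand side is
    enlarged, by comparison of integrals. *)
Lemma duhamel_le (t : R) : 0 < t -> duhamel phi u -> positive_solution u ->
  {ae mu, forall x, ((`|u t x|)%:E <= heat_semigroup t (fun y => `|phi y|)%R x +
    \int[leb]_(s in `]0%R, t[) source u t s x)%E}.
Proof.
move=> t0 /(_ t t0) du /(_ t t0) pu; apply: filterS2 du pu => x ux u0.
rewrite gtr0_norm// ux leeD//.
  by apply: le_heat_semigroup => // y; exact: ler_norm.
apply: ge0_le_integral_nomeas => s; rewrite /= in_itv/= => /andP[s0 st].
  exact: source_ge0.
by apply: le_heat_semigroup; rewrite ?subr_gt0// => y; exact: ler_norm.
Qed.

Lemma duhamel_combine (t p A A2 W S : R) :
  0 < t -> 1 <= p -> measurable_fun setT phi -> measurable_fun setT (u t) ->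
  duhamel phi u -> positive_solution u ->
  0 < A -> 0 < W ->
  (\int[mu]_x heat_semigroup t (fun y => `|phi y|)%R x `^ p <= (A `^ p)%:E)%E ->
  (forall x, heat_semigroup t (fun y => `|phi y|)%R x <= A2%:E)%E ->
  (exists V : Rn R n -> \bar R, [/\ measurable_fun setT V,
    forall x, (0 <= V x)%E,
    forall x, (\int[leb]_(s in `]0%R, t[) source u t s x <= V x)%E &
    (\int[mu]_x V x `^ p <= (W `^ p)%:E)%E]) ->
  (forall x, \int[leb]_(s in `]0%R, t[) source u t s x <= S%:E)%E ->
  (\int[mu]_x (`|u t x| `^ p)%:E <= ((A + W) `^ p)%:E)%E /\
  {ae mu, forall x, `|u t x| <= A2 + S}.
Proof.
move=> t0 p1 mphi mut du pu A0 W0 hA hA2 [V [mV V0 sV VW]] sS.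
have ul := duhamel_le t0 du pu.
have mphi' : measurable_fun setT (fun y => `|phi y|) by exact: measurableT_comp.
split.
  apply: (@integral_powR_add_le _ _ _ mu p A W (fun x => (`|u t x|)%:E)
    (heat_semigroup t (fun y => `|phi y|)) V) => //.
  - by apply/measurable_EFinP; exact: measurableT_comp.
  - exact: measurable_heat_semigroup.
  - by move=> x; exact: heat_semigroup_ge0.
  - by apply: filterS ul => x /le_trans; apply; rewrite leeD2l.
apply: filterS ul => x /le_trans ux; rewrite -lee_fin EFinD; apply: ux.
by rewrite leeD.
Qed.

End duhamel_combine.

(** * Bookkeeping of constants *)

Section real_arithmetic.
Variable R : realFieldType.
Implicit Types a b c d x y z w : R.

Lemma half_le_sub a b c d : a <= b -> 2 * b <= c -> c <= d -> d / 2 <= d - a.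
Proof. lra. Qed.

Lemma budget_integral a x x2 y z z2 : 0 < a -> x <= x2 -> 2 * x2 <= a ->
  y <= a -> z <= z2 -> z2 <= a -> a + (x + y + z) <= 4 * a.
Proof. lra. Qed.

Lemma budget_sup a x z w : 0 < a -> 2 * x <= a -> z <= a -> w <= a ->
  a + (x + z + w) <= 4 * a.
Proof. lra. Qed.

(** Makes the exponent r = n admissible in [nonlin_powR_le]. *)
Lemma dim_exponent a : 1 <= a -> 2 <= a * (1 + 4 / a).
Proof.
move=> a1; rewrite mulrDr mulr1 mulrCA divff ?mulr1; first lra.
by rewrite gt_eqF// (lt_le_trans _ a1).
Qed.

Lemma sub_le_of_lt_add a b c d : a < b + c -> c <= d -> a - b <= d.
Proof. lra. Qed.

Lemma budget_factor a b k c d x w :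
  a * x + (a * b * k * c + a * b * d + a * w) = a * (x + (b * (k * c) + b * d + w)).
Proof. ring. Qed.

Lemma mul_div_add1_le a b : 0 <= a -> 0 <= b -> a * (b / (a + 1)) <= b.
Proof.
move=> a0 b0; rewrite mulrCA ler_piMr// ler_pdivrMr ?mul1r ?lerDl//.
by rewrite ltr_wpDl.
Qed.

Lemma le_of_scaled a b c : 0 <= a -> 1 <= b -> b * a <= c -> a <= c.
Proof. by move=> a0 b1; apply: le_trans; rewrite ler_peMl. Qed.

Lemma sub_half_le a b c : 4 * b <= c -> a <= 2 * b -> c / 2 <= c - a.
Proof. lra. Qed.

Lemma budget_five a x y : 0 <= a -> x <= a -> y <= 2 * a ->
  2 * a + (x + y) <= 8 * a.
Proof. lra. Qed.

Lemma budget_factor2 a b k c x w :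
  a * x + (a * b * k * c + a * b * w) = a * (x + (b * (k * c) + b * w)).
Proof. ring. Qed.

End real_arithmetic.

Lemma powR_half (R : realType) (t b : R) : 0 <= t ->
  (t / 2) `^ (- b) = t `^ (- b) * 2 `^ b.
Proof.
move=> t0; rewrite powRM ?invr_ge0//; congr (_ * _).
by rewrite -powR_inv1// -powRrM mulN1r opprK.
Qed.

Lemma ler_powRN2 (R : realType) (b x y : R) : 0 <= b -> 0 < x -> x <= y ->
  y `^ (- b) <= x `^ (- b).
Proof.
move=> b0 x0 xy; have y0 := lt_le_trans x0 xy.
rewrite !powRN lef_pV2 ?posrE ?powR_gt0//.
by apply: ge0_ler_powR; rewrite // nnegrE ltW.
Qed.

Lemma tail_gt0 (R : realType) (n : nat) (p D tc : R) :
  1 <= p -> p < 2 -> 0 < D -> 0 < tc -> 0 < tail n p D tc.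
Proof.
move=> p1 p2 D0 tc0; have p0 : 0 < p by rewrite (lt_le_trans _ p1).
have a1 : 0 < 2 / p - 1 by rewrite subr_gt0 ltr_pdivlMr// mul1r.
rewrite /tail mulr_gt0//.
  by rewrite mulr_gt0// mulr_gt0 ?powR_gt0// mulr_gt0 ?powR_gt0 ?expR_gt0.
by rewrite divr_gt0 ?powR_gt0.
Qed.

(** * Propagation of the decay bounds in time *)

Section bootstrap.
Variables (R : realType) (n : nat) (phi : Rn R n -> R) (u : R -> Rn R n -> R).
Variable p : R.
Hypothesis n0 : (0 < n)%N.
Hypothesis mphi : measurable_fun setT phi.
Hypothesis mu_ : forall s, 0 < s -> measurable_fun setT (u s).
Hypothesis cu : continuous_expL2 u.
Hypothesis du : duhamel phi u.
Hypothesis pu : positive_solution u.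
Hypothesis p1 : 1 <= p.
Hypothesis p2 : p < 2.
Hypothesis pn : 2 <= p * (1 + 4 / n%:R).
Local Notation mu := (lebesgueRn R n).
Local Notation leb := (@lebesgue_measure R).
Local Notation beta := (n%:R / (2 * p)).
Local Notation alpha := (2 / p).

Variable l : R.
Hypothesis l0 : 0 < l.
Hypothesis ul : forall s, 0 < s -> (expL2_norm (u s) < l%:E)%E.

Let p0 : 0 < p. Proof. exact: lt_le_trans p1. Qed.
Let n0R : (0 : R) < n%:R. Proof. by rewrite ltr0n. Qed.
Let n1R : (1 : R) <= n%:R. Proof. by rewrite ler1n. Qed.

Lemma kappa_ge0 (r k : R) : 0 <= kappa n r k.
Proof. by rewrite mulr_ge0 ?powR_ge0. Qed.

(** Applied with r = p away from s = t, with r = n near s = t, where the rate is (t - s)^(-1/2), and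
    with r < p to gain decay in the little-o statement. *)
Lemma source_kappa (t s r : R) : 0 < s -> s < t -> 1 <= r ->
  r * l ^+ 2 <= 4^-1 -> 2 <= r * (1 + 4 / n%:R) ->
  [/\ (\int[mu]_x source u t s x `^ r <= (kappa n r l `^ r)%:E)%E,
      forall x, (source u t s x <=
        ((t - s) `^ (- (n%:R / (2 * r))) * kappa n r l)%:E)%E &
      r <= p -> (\int[mu]_x source u t s x `^ p <=
        (((t - s) `^ (- (n%:R / 2 * (r^-1 - p^-1))) * kappa n r l) `^ p)%:E)%E].
Proof.
move=> s0 st r1 rl rn; have ts : 0 < t - s by rewrite subr_gt0.
have r0 : 0 < r by rewrite (lt_le_trans _ r1).
have H := integral_nonlin_le r0 rl rn (mu_ s0) (ul s0).
have mf : measurable_fun setT (fun y => `|nonlin n (u s y)|).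
  by apply: measurableT_comp => //; apply: measurable_nonlin; exact: mu_.
have f0 y : 0 <= `|nonlin n (u s y)| by [].
split.
- by rewrite (le_trans (heat_semigroup_contract ts mf f0 r1)).
- by move=> x; exact: heat_semigroup_le_sup ts mf f0 r1 (kappa_ge0 _ _) H.
- by move=> rp; exact: heat_semigroup_le_powR ts mf f0 r1 rp (kappa_ge0 _ _) H.
Qed.

Variables (M m tc : R).
Hypothesis M0 : 0 < M.
Hypothesis m0 : 0 <= m.
Hypothesis phim : (\int[mu]_x (`|phi x| `^ p)%:E <= (m `^ p)%:E)%E.
Hypothesis tc1 : 1 <= tc.
Hypothesis pl : p * l ^+ 2 <= 4^-1.
Hypothesis nl : n%:R * l ^+ 2 <= 4^-1.

Local Notation N := (M + m).
Local Notation D := (4 * (M + m)).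
Local Notation kp := (kappa n p l).
Local Notation kn := (kappa n n%:R l).

Hypothesis small_tail : 2 `^ beta * tail n p D tc <= N.
Hypothesis small_kp : 2 `^ beta * (kp * (2 * tc)) <= N.
Hypothesis small_kn :
  2 * kn * (2 * tc) `^ 2^-1 * (2 * tc) `^ beta <= N.

Let N0 : 0 < N. Proof. by rewrite ltr_wpDr. Qed.
Let D0 : 0 < D. Proof. by rewrite mulr_gt0. Qed.
Let tc0 : 0 < tc. Proof. exact: lt_le_trans tc1. Qed.
Let beta0 : 0 <= beta. Proof. by rewrite divr_ge0 ?mulr_ge0 ?ltW. Qed.

Let pow2_ge1 : 1 <= 2 `^ beta :> R.
Proof. by rewrite -[leLHS](powRr0 2); apply: ler_powR => //; rewrite ler1n. Qed.

Lemma heat_initial (t : R) : 0 < t ->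
  (\int[mu]_x heat_semigroup t (fun y => `|phi y|)%R x `^ p <= (N `^ p)%:E)%E /\
  (forall x, heat_semigroup t (fun y => `|phi y|)%R x <=
    (t `^ (- beta) * N)%:E)%E.
Proof.
move=> t0; have mf : measurable_fun setT (fun y => `|phi y|).
  exact: measurableT_comp.
have mN : m `^ p <= N `^ p.
  by apply: ge0_ler_powR; rewrite ?nnegrE ?(ltW p0) ?(ltW N0) ?lerDr ?(ltW M0).
split.
  rewrite (le_trans (heat_semigroup_contract t0 mf _ p1))//.
  by rewrite (le_trans phim)// lee_fin.
move=> x; apply: (heat_semigroup_le_sup x t0 mf _ p1 (ltW N0)) => //.
by rewrite (le_trans phim)// lee_fin.
Qed.

(** The datum, the times before [tc], those between [tc] and [T] and those after [T] contribute at
    most N each, whence the 4 in D. If 2 tc <= T, sources at s <= tc have t - s >= t/2 and so decay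
    at the full rate; if T = 0, no earlier bound is used. *)
Lemma bounded_step (t T : R) : 0 < t -> 0 <= T -> T <= t ->
  (T = 0 \/ 2 * tc <= T) ->
  (forall s, 0 < s -> s < T -> bounded_at u p D s) ->
  kp * (t - T) <= N -> 2 * kn * (t - T) `^ 2^-1 * t `^ beta <= N ->
  bounded_at u p D t.
Proof.
move=> t0 T0 Tt TT HD kpT knT.
pose a' := (t / 2) `^ (- beta) * kp.
have n4 : 2 <= n%:R * (1 + 4 / n%:R) :> R by exact: dim_exponent.
have Hp s (s0 : 0 < s) (st : s < t) := source_kappa s0 st p1 pl pn.
have Hn s (s0 : 0 < s) (st : s < t) := source_kappa s0 st n1R nl n4.
have [|||||||||SV SS] := @duhamel_step R n u p n0 mu_ cu p1 p2 t tc T D kp a' kp kn t0 tc1 T0 Tt D0.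
- exact: kappa_ge0.
- by rewrite mulr_ge0 ?powR_ge0 ?kappa_ge0.
- exact: kappa_ge0.
- exact: kappa_ge0.
- by move=> s s0 st _; have [] := Hp s s0 st.
- move=> s x s0 sT stc st; have [_ /(_ x)/le_trans + _] := Hp s s0 st; apply.
  rewrite lee_fin ler_wpM2r ?kappa_ge0//.
  case: TT => [T00|T2]; first by move: sT; rewrite T00 ltNge (ltW s0).
  have th : 0 < t / 2 by rewrite divr_gt0.
  have ts : t / 2 <= t - s by exact: half_le_sub stc T2 Tt.
  exact: ler_powRN2.
- by move=> s s0 st; have [] := Hp s s0 st.
- move=> s x _ s0 st; have [_ /(_ x)/le_trans + _] := Hn s s0 st; apply.
  have -> : n%:R / (2 * n%:R) = 2^-1 :> R by field; rewrite gt_eqF.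
  by rewrite mulrC.
- move=> s tcs sT; apply: HD => //; exact: lt_trans tcs.
have [hp hs] := heat_initial t0.
have tail1 := tail_gt0 n p1 p2 D0 tc0.
have W0 : 0 < kp * tc + kp * (t - T) + tail n p D tc.
  rewrite ltr_wpDl//; apply: addr_ge0; apply: mulr_ge0; rewrite ?kappa_ge0//.
    exact: ltW.
  by rewrite subr_ge0.
have kpN : kp * tc <= 2 `^ beta * (kp * tc).
  by rewrite ler_peMl//; apply: mulr_ge0; rewrite ?kappa_ge0// ltW.
have kpN2 : 2 `^ beta * (kp * (2 * tc)) = 2 * (2 `^ beta * (kp * tc)) by ring.
have tailN : tail n p D tc <= 2 `^ beta * tail n p D tc by rewrite ler_peMl// ltW.
have kp0 : 0 <= kp * tc by apply: mulr_ge0; rewrite ?kappa_ge0// ltW.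
move: small_kp small_tail N0 kpT knT; rewrite kpN2 => skp stl N0' kpT' knT'.
have [b1 b2] := duhamel_combine t0 p1 mphi (mu_ t0) du pu N0 W0 hp hs SV SS.
split.
  rewrite (le_trans b1)// lee_fin; apply: ge0_ler_powR.
  - exact: ltW.
  - by rewrite nnegrE addr_ge0 ?(ltW N0) ?(ltW W0).
  - by rewrite nnegrE ltW.
  - exact: budget_integral N0' kpN skp kpT' tailN stl.
apply: filterS b2 => x /le_trans; apply.
rewrite -[D * _]mulrC.
have tb0 : 0 < t `^ (- beta) by rewrite powR_gt0.
have tb : t `^ (- beta) * t `^ beta = 1.
  by rewrite -powRD ?addNr ?powRr0// (gt_eqF t0) implybT.
have t2 := powR_half beta (ltW t0).
have -> : kn * (2 * (t - T) `^ 2^-1) =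
    t `^ (- beta) * (2 * kn * (t - T) `^ 2^-1 * t `^ beta).
  by rewrite [RHS]mulrCA tb mulr1; ring.
rewrite /a' t2.
rewrite budget_factor.
rewrite ler_wpM2l ?(ltW tb0)//.
exact: budget_sup N0' skp stl knT'.
Qed.

(* If some time were bad, let T be the infimum of the bad times. All times before
   T are good, and [bounded_step] makes the times shortly after T good as well,
   because the contribution of [T, t] is small by the exp L^2 bounds alone. *)
Lemma bootstrap (t : R) : 0 < t -> bounded_at u p D t.
Proof.
apply: contraPP => Hb t0.
have kp0 := kappa_ge0 p l.
have kn0 := kappa_ge0 n%:R l.
(* Up to 2 tc the exp L^2 bounds suffice. Bad times therefore lie at or beyond 2 tc, as
   [bounded_step] requires of a positive T. *)
have base s : 0 < s -> s <= 2 * tc -> bounded_at u p D s.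
  move=> s0 stc; apply: (@bounded_step s 0) => //; first exact: ltW.
  - by left.
  - by move=> s' s'0 /(lt_trans s'0); rewrite ltxx.
  - have tc20 : 0 <= 2 * tc by apply: mulr_ge0 => //; exact: ltW.
    rewrite subr0; apply: le_trans (ler_wpM2l kp0 stc) _.
    exact: le_of_scaled (mulr_ge0 kp0 tc20) pow2_ge1 small_kp.
  - rewrite subr0; apply: le_trans _ small_kn.
    have tc20 : 0 <= 2 * tc by apply: mulr_ge0 => //; exact: ltW.
    have kn20 : 0 <= 2 * kn by exact: mulr_ge0.
    have mono (a : R) : 0 <= a -> s `^ a <= (2 * tc) `^ a.
      by move=> a0; apply: ge0_ler_powR => //; rewrite nnegrE ltW.
    apply: ler_pM; [|exact: powR_ge0| |exact: mono].
      by apply: mulr_ge0 => //; exact: powR_ge0.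
    by apply: ler_wpM2l => //; apply: mono; rewrite invr_ge0.
pose E := [set s : R | 0 < s /\ ~ bounded_at u p D s].
have E0 : E !=set0 by exists t.
have lbE : lbound E (2 * tc).
  move=> s [s0 bs]; rewrite leNgt; apply/negP => stc.
  by apply: bs; apply: base => //; exact: ltW.
pose T := inf E.
have T2 : 2 * tc <= T by exact: lb_le_inf.
have T0 : 0 < T by rewrite (lt_le_trans _ T2)// mulr_gt0.
have HT s : 0 < s -> s < T -> bounded_at u p D s.
  move=> s0 sT; apply: contrapT => bs.
  have : T <= s by apply: ge_inf => //; exists (2 * tc).
  by rewrite leNgt sT.
(* [c1] and the square of [c2] make the two contributions of [T, s] at most N, and dl <= 1 gives s
   <= T + 1, on which [c2] relies. Adding 1 keeps the denominators positive. *)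
pose c1 := N / (kp + 1).
pose c2 := (N / (2 * kn * (T + 1) `^ beta + 1)).
pose dl := Num.min 1 (Num.min c1 (c2 ^+ 2)).
have kp10 : 0 < kp + 1 := ltr_wpDl kp0 ltr01.
have kn20 : 0 <= 2 * kn by exact: mulr_ge0.
have q0 : 0 <= 2 * kn * (T + 1) `^ beta := mulr_ge0 kn20 (powR_ge0 _ _).
have q10 : 0 < 2 * kn * (T + 1) `^ beta + 1 := ltr_wpDl q0 ltr01.
have c10 : 0 < c1 := divr_gt0 N0 kp10.
have c20 : 0 < c2 := divr_gt0 N0 q10.
have dl0 : 0 < dl by rewrite !lt_min ltr01 c10 exprn_gt0.
have : T + dl <= T.
  apply: lb_le_inf => // s [s0 bs]; rewrite leNgt; apply/negP => sT; apply: bs.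
  have [sT'|Ts] := ltP s T; first exact: HT.
  have d1 : s - T <= 1 by apply: (sub_le_of_lt_add sT); rewrite !ge_min lexx.
  have d2 : s - T <= c1.
    by apply: (sub_le_of_lt_add sT); rewrite !ge_min lexx ?orbT.
  have d3 : s - T <= c2 ^+ 2.
    by apply: (sub_le_of_lt_add sT); rewrite !ge_min lexx ?orbT.
  apply: (@bounded_step s T) => //; [exact: ltW|by right| |].
    apply: le_trans (ler_wpM2l kp0 d2) _.
    exact: mul_div_add1_le kp0 (ltW N0).
  have h1 : (s - T) `^ 2^-1 <= c2.
    by rewrite powR12_sqrt ?subr_ge0// -[leRHS](ger0_norm (ltW c20)) -sqrtr_sqr
      ler_wsqrtr.
  have h2 : s `^ beta <= (T + 1) `^ beta.
    by apply: ge0_ler_powR; rewrite ?nnegrE ?(ltW s0) ?addr_ge0 ?(ltW T0)// addrC -lerBlDr.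
  apply: le_trans (mul_div_add1_le q0 (ltW N0)); rewrite mulrAC.
  apply: ler_pM => //; [|exact: powR_ge0|exact: ler_wpM2l].
  by apply: mulr_ge0 => //; exact: powR_ge0.
by rewrite gerDl leNgt dl0.
Qed.

End bootstrap.

(** * Splitting the initial datum *)

(** Where g > c one has g^r <= c^(r-p) g^p, so the large values belong to L^r; the small values tend
    to 0 in L^p as c decreases to 0, by dominated convergence. *)
Lemma split_level d (T : measurableType d) (R : realType)
    (mu : {measure set T -> \bar R}) (g : T -> R) (r p e : R) :
  1 <= r -> r < p -> 0 < e -> measurable_fun setT g -> (forall x, 0 <= g x) ->
  (\int[mu]_x (g x `^ p)%:E < +oo)%E ->
  exists (g1 g2 : T -> R) (K : R), [/\
    [/\ measurable_fun setT g1, measurable_fun setT g2,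
        forall x, 0 <= g1 x, forall x, 0 <= g2 x & forall x, g x = g1 x + g2 x],
    0 <= K, (\int[mu]_x (g1 x `^ r)%:E <= (K `^ r)%:E)%E &
    (\int[mu]_x (g2 x `^ p)%:E <= (e `^ p)%:E)%E].
Proof.
move=> r1 rp e0 mg g0 gp; have r0 : 0 < r by rewrite (lt_le_trans _ r1).
have p0 : 0 < p by rewrite (lt_trans r0).
pose lo (c : R) x := if g x <= c then g x else 0.
pose hi (c : R) x := if g x <= c then 0 else g x.
have mlo c : measurable_fun setT (lo c).
  by apply: measurable_fun_ifT => //; exact: measurable_fun_ler.
have mhi c : measurable_fun setT (hi c).
  by apply: measurable_fun_ifT => //; exact: measurable_fun_ler.
have lo0 c x : 0 <= lo c x by rewrite /lo; case: ifP.
have hi0 c x : 0 <= hi c x by rewrite /hi; case: ifP.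
have mgp : measurable_fun setT (fun x => (g x `^ p)%:E).
  by apply/measurable_EFinP; exact: measurable_fun_powR.
pose F (k : nat) x := (lo k.+1%:R^-1 x `^ p)%:E.
have mF k : measurable_fun setT (F k).
  by apply/measurable_EFinP; exact: measurable_fun_powR.
have lol c x : lo c x `^ p <= g x `^ p.
  by apply: ge0_ler_powR; rewrite ?nnegrE ?(ltW p0)// /lo; case: ifP.
have Fcvg : (\int[mu]_x F k x)%E @[k --> \oo] --> (\int[mu]_x (cst 0 x))%E.
  apply: (@dominated_cvg _ _ _ mu setT measurableT F (cst 0%E)
    (fun x => (g x `^ p)%:E)) => //.
  - move=> x _; have [g00|gx0] := eqVneq (g x) 0.
      rewrite [X in X @ _ --> _](_ : _ = fun=> 0%E); first exact: cvg_cst.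
      by apply/funext => k; rewrite /F /lo g00 if_same powR0// gt_eqF.
    have gx : 0 < g x by rewrite lt_def gx0 g0.
    apply: cvg_near_cst; near=> k.
    rewrite /F /lo leNgt ifF ?powR0 ?gt_eqF//; apply/negbF.
    near: k; exact: near_infty_natSinv_lt (PosNum gx).
  - apply/integrableP; split => //.
    by under eq_integral do rewrite gee0_abs ?lee_fin ?powR_ge0//.
  - by move=> k x _; rewrite gee0_abs ?lee_fin ?powR_ge0.
rewrite integral0 in Fcvg.
have [k Fk] : exists k, (\int[mu]_x F k x < (e `^ p)%:E)%E.
  have ep0 : 0 < e `^ p by rewrite powR_gt0.
  have [k _ Fk] := Fcvg _ (@nbhs_open_ereal_lt _ 0 (fun=> e `^ p) ep0).
  by exists k; apply: (Fk k) => /=.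
pose c : R := k.+1%:R^-1.
have c0 : 0 < c by rewrite invr_gt0 ltr0n.
have [I IE] : exists I, (\int[mu]_x (g x `^ p)%:E = I%:E)%E.
  exists (fine (\int[mu]_x (g x `^ p)%:E)); rewrite fineK// ge0_fin_numE//.
  by apply: integral_ge0 => x _; rewrite lee_fin powR_ge0.
have I0 : 0 <= I.
  rewrite -lee_fin -IE; apply: integral_ge0 => x _; by rewrite lee_fin powR_ge0.
exists (hi c), (lo c), ((c `^ (r - p) * I) `^ r^-1); split.
- split => // x; rewrite /hi /lo; by case: ifP; rewrite ?add0r ?addr0.
- exact: powR_ge0.
- rewrite -powRrM mulVf ?gt_eqF// powRr1 ?mulr_ge0 ?powR_ge0// EFinM -IE.
  rewrite -ge0_integralZl//; last 2 first.
  + by move=> x _; rewrite lee_fin powR_ge0.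
  + by rewrite lee_fin powR_ge0.
  apply: ge0_le_integral_nomeas => x _; rewrite -EFinM lee_fin.
    by rewrite mulr_ge0 ?powR_ge0.
  rewrite /hi; case: ifPn => [_|]; last rewrite -ltNge => cg.
    by rewrite powR0 ?gt_eqF// mulr_ge0 ?powR_ge0.
  have gx0 : 0 < g x by rewrite (lt_trans c0).
  have -> : g x `^ r = g x `^ (r - p) * g x `^ p.
    by rewrite -powRD ?subrK// (gt_eqF gx0) implybT.
  rewrite ler_wpM2r ?powR_ge0// -(opprB p r) !powRN.
  rewrite lef_pV2 ?posrE ?powR_gt0//.
  by apply: ge0_ler_powR; rewrite ?nnegrE ?subr_ge0 ltW.
- exact: ltW.
Unshelve. all: by end_near. Qed.

Lemma exists_powR_small (R : realType) (X a : R) : 0 <= X -> 0 < a ->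
  exists2 y, 1 <= y & forall z, y <= z -> X * z `^ (- a) <= 1.
Proof.
move=> X0 a0; have X1 : 0 < 1 + X by rewrite ltr_wpDr.
have y1 : 1 <= (1 + X) `^ a^-1.
  rewrite -[Z in Z <= _](powRr0 (1 + X)); apply: ler_powR; first by rewrite lerDl.
  by rewrite invr_ge0 ltW.
exists ((1 + X) `^ a^-1) => // z yz.
have z0 : 0 < z by rewrite (lt_le_trans _ yz)// (lt_le_trans _ y1).
rewrite powRN ler_pdivrMr ?powR_gt0// mul1r.
apply: (@le_trans _ _ (1 + X)); first by rewrite lerDr.
have E : 1 + X = ((1 + X) `^ a^-1) `^ a.
  by rewrite -powRrM mulVf ?gt_eqF// powRr1// ltW.
rewrite [leLHS]E.
by apply: ge0_ler_powR; rewrite ?nnegrE ?powR_ge0 ?(ltW a0) ?(ltW z0).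
Qed.

(** * The little-o decay *)

Section decay.
Variables (R : realType) (n : nat) (phi : Rn R n -> R) (u : R -> Rn R n -> R).
Variable p : R.
Hypothesis n0 : (0 < n)%N.
Hypothesis mphi : measurable_fun setT phi.
Hypothesis mu_ : forall s, 0 < s -> measurable_fun setT (u s).
Hypothesis cu : continuous_expL2 u.
Hypothesis du : duhamel phi u.
Hypothesis pu : positive_solution u.
Hypothesis p1 : 1 <= p.
Hypothesis p2 : p < 2.
Local Notation mu := (lebesgueRn R n).
Local Notation leb := (@lebesgue_measure R).
Local Notation beta := (n%:R / (2 * p)).
Local Notation alpha := (2 / p).

Let p0 : 0 < p. Proof. exact: lt_le_trans p1. Qed.
Let n0R : (0 : R) < n%:R. Proof. by rewrite ltr0n. Qed.

Lemma le_growth (D D' : R) : 0 <= D -> D <= D' -> growth n D <= growth n D'.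
Proof.
move=> D0 DD'; have D'0 := le_trans D0 DD'.
apply: ler_pM; rewrite ?powR_ge0 ?expR_ge0//.
  by apply: ge0_ler_powR; rewrite ?nnegrE ?divr_ge0.
by rewrite ler_expR ler_pXn2r ?nnegrE.
Qed.

(** [tail] is D times [growth] times a negative power of [tc], and [growth] is monotone, so one [tc]
    serves every D <= D'. The bound is proportional to D because D will depend on M, chosen after
    [tc]. *)
Lemma tail_small (D' e : R) : 0 < D' -> 0 < e ->
  exists2 tc, 1 <= tc & forall D, 0 < D -> D <= D' ->
    2 `^ beta * tail n p D tc <= e * D.
Proof.
move=> D'0 e0; have a0 : 0 < alpha - 1.
  by rewrite subr_gt0 ltr_pdivlMr// mul1r.
pose X := 2 `^ beta * (2 `^ (alpha + 1) * growth n D' / (alpha - 1)) / e.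
have X0 : 0 <= X.
  rewrite /X divr_ge0 ?(ltW e0)//; apply: mulr_ge0; first exact: powR_ge0.
  by rewrite divr_ge0 ?(ltW a0)// mulr_ge0 ?powR_ge0 ?growth_ge0.
have [tc tc1 /(_ tc (lexx _)) H] := exists_powR_small X0 a0.
exists tc => // D D0 DD'.
have tp0 := powR_ge0 tc (1 - alpha).
rewrite opprB in H.
apply: (@le_trans _ _ (e * D * (X * tc `^ (1 - alpha)))); last first.
  by rewrite ler_piMr// mulr_ge0 ?(ltW e0) ?(ltW D0).
have -> : e * D * (X * tc `^ (1 - alpha)) = 2 `^ beta * (2 `^ (alpha + 1) *
    growth n D' * D * (tc `^ (1 - alpha) / (alpha - 1))).
  rewrite /X; move: (alpha - 1) a0 => am a0.
  by field; rewrite !gt_eqF.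
rewrite /tail; apply: ler_wpM2l; first exact: powR_ge0.
apply: ler_wpM2r; first by rewrite divr_ge0 ?(ltW a0).
apply: ler_wpM2r; first exact: ltW.
apply: ler_wpM2l; first exact: powR_ge0.
by apply: le_growth => //; exact: ltW.
Qed.

Variables (l D r : R).
Hypothesis l0 : 0 < l.
Hypothesis ul : forall s, 0 < s -> (expL2_norm (u s) < l%:E)%E.
Hypothesis D0 : 0 < D.
Hypothesis uD : forall t, 0 < t -> bounded_at u p D t.
Hypothesis phip : (\int[mu]_x (`|phi x| `^ p)%:E < +oo)%E.
Hypothesis r1 : 1 <= r.
Hypothesis rp : r < p.
Hypothesis rn : 2 <= r * (1 + 4 / n%:R).
Hypothesis pl : p * l ^+ 2 <= 4^-1.
Local Notation gamma := (n%:R / 2 * (r^-1 - p^-1)).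

Let r0 : 0 < r. Proof. exact: lt_le_trans r1. Qed.

Let gamma0 : 0 < gamma.
Proof.
by rewrite mulr_gt0 ?divr_gt0// subr_gt0 ltf_pV2.
Qed.

Let exp_split : n%:R / (2 * r) = beta + gamma.
Proof. by field; rewrite !gt_eqF. Qed.

(** [K] bounds the L^r part of the datum, which gains t^(-gamma) in both estimates; the other part
    has L^p norm at most e at all times. *)
Lemma heat_initial_decay (e : R) : 0 < e -> exists2 K, 0 <= K &
  forall t, 0 < t -> K * t `^ (- gamma) <= e ->
  (\int[mu]_x heat_semigroup t (fun y => `|phi y|)%R x `^ p <=
    ((2 * e) `^ p)%:E)%E /\
  (forall x, heat_semigroup t (fun y => `|phi y|)%R x <=
    (t `^ (- beta) * (2 * e))%:E)%E.
Proof.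
move=> e0; have mf : measurable_fun setT (fun y => `|phi y|).
  exact: measurableT_comp.
have [g1 [g2 [K [[mg1 mg2 g10 g20 gE] K0 HK He]]]] :=
  split_level r1 rp e0 mf (fun x => normr_ge0 _) phip.
exists K => // t t0 Kt.
have HE x : (heat_semigroup t (fun y => `|phi y|)%R x =
    heat_semigroup t g1 x + heat_semigroup t g2 x)%E.
  have G0 y := ltW (heat_kernel_gt0 (subRn x y) t0).
  rewrite /heat_semigroup; under eq_integral do rewrite gE mulrDr EFinD.
  rewrite ge0_integralD//.
  - by move=> y _; rewrite lee_fin mulr_ge0.
  - apply/measurable_EFinP; apply: measurable_funM => //.
    exact: measurable_heat_kernel.
  - by move=> y _; rewrite lee_fin mulr_ge0.
  - apply/measurable_EFinP; apply: measurable_funM => //.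
    exact: measurable_heat_kernel.
have tK : t `^ (- gamma) * K <= e by rewrite mulrC.
have tK0 : 0 <= t `^ (- gamma) * K by rewrite mulr_ge0 ?powR_ge0.
have -> : 2 * e = e + e by ring.
split.
  apply: (@integral_powR_add_le _ _ _ mu p e e _
      (heat_semigroup t g1) (heat_semigroup t g2)) => //.
  - exact: measurable_heat_semigroup.
  - exact: measurable_heat_semigroup.
  - exact: measurable_heat_semigroup.
  - by move=> x; exact: heat_semigroup_ge0.
  - by move=> x; exact: heat_semigroup_ge0.
  - by move=> x; exact: heat_semigroup_ge0.
  - by apply: nearW => x; rewrite HE.
  - apply: le_trans (heat_semigroup_le_powR t0 mg1 g10 r1 (ltW rp) K0 HK) _.
    by rewrite lee_fin; apply: ge0_ler_powR; rewrite ?nnegrE ?(ltW e0) ?(ltW p0).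
  - exact: le_trans (heat_semigroup_contract t0 mg2 g20 p1) He.
move=> x; rewrite HE mulrDr EFinD; apply: leeD.
  apply: le_trans (heat_semigroup_le_sup x t0 mg1 g10 r1 K0 HK) _.
  rewrite lee_fin exp_split opprD powRD ?(gt_eqF t0) ?implybT// -mulrA.
  by rewrite ler_wpM2l// powR_ge0.
exact: heat_semigroup_le_sup x t0 mg2 g20 p1 (ltW e0) He.
Qed.

Lemma decay_at_infinity (e : R) : 0 < e ->
  \forall t \near +oo, bounded_at u p e t.
Proof.
(* The datum costs 2 d, the times before [tc] at most d and the tail at most 2 d, within the budget
   of 8 d. *)
move=> e0; pose d := e / 8.
have d0 : 0 < d by rewrite divr_gt0.
have [K K0 HK] := heat_initial_decay d0.
have [tc tc1 Htc] := tail_small D0 (divr_gt0 (mulr_gt0 (ltr0n R 2) d0) D0).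
have {Htc} tail2 : 2 `^ beta * tail n p D tc <= 2 * d.
  by rewrite (le_trans (Htc D D0 (lexx _)))// divfK// gt_eqF.
have tc0 : 0 < tc by rewrite (lt_le_trans _ tc1).
pose k1 := kappa n r l.
have k10 : 0 <= k1 by exact: kappa_ge0.
have kp0 : 0 <= kappa n p l by exact: kappa_ge0.
have pow2_ge1 : 1 <= 2 `^ beta :> R.
  rewrite -[Z in Z <= _](powRr0 2); apply: ler_powR; first by rewrite ler1n.
  by rewrite divr_ge0// mulr_ge0// ltW.
have b0 : 0 <= beta by rewrite divr_ge0// mulr_ge0// ltW.
have Y0 : 0 <= 2 `^ beta * (k1 * tc).
  by apply: mulr_ge0; [exact: powR_ge0|exact: mulr_ge0 k10 (ltW tc0)].
have X0 : 0 <= (K + 2 `^ beta * (k1 * tc)) / d.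
  by apply: divr_ge0; [exact: addr_ge0|exact: ltW].
(* One threshold makes both the datum and the early source small; the latter carries (t/2)^(-gamma),
   hence the requirement y <= t/2. *)
have [y y1 Hy] := exists_powR_small X0 gamma0.
have rl : r * l ^+ 2 <= 4^-1.
  by rewrite (le_trans _ pl)// ler_wpM2r ?sqr_ge0// ltW.
have pn : 2 <= p * (1 + 4 / n%:R).
  by rewrite (le_trans rn)// ler_wpM2r ?addr_ge0 ?divr_ge0// ltW.
near=> t.
have ty : 2 * y <= t by near: t; apply: nbhs_pinfty_ge; exact: num_real.
have t4 : 4 * tc <= t by near: t; apply: nbhs_pinfty_ge; exact: num_real.
have t0 : 0 < t by near: t; apply: nbhs_pinfty_gt; exact: num_real.
have th0 : 0 < t / 2 by rewrite divr_gt0.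
have yt2 : y <= t / 2 by rewrite ler_pdivlMr// mulrC.
have scale z : y <= z -> (K + 2 `^ beta * (k1 * tc)) * z `^ (- gamma) <= d.
  by move=> /Hy; rewrite mulrAC ler_pdivrMr// mul1r.
have Kt : K * t `^ (- gamma) <= d.
  apply: le_trans (scale t _).
    by rewrite ler_wpM2r ?powR_ge0// lerDl.
  by rewrite (le_trans yt2)// ler_pdivrMr// ler_peMr ?ler1n// ltW.
pose q := k1 * (t / 2) `^ (- gamma).
have q0 : 0 <= q by exact: mulr_ge0 k10 (powR_ge0 _ _).
have qd : 2 `^ beta * (q * tc) <= d.
  have -> : 2 `^ beta * (q * tc) = 2 `^ beta * (k1 * tc) * (t / 2) `^ (- gamma).
    by rewrite /q; ring.
  by apply: le_trans (scale _ yt2); rewrite ler_wpM2r ?powR_ge0// lerDr.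
have qtc0 : 0 <= q * tc by exact: mulr_ge0 q0 (ltW tc0).
have qd' : q * tc <= d by exact: le_of_scaled qtc0 pow2_ge1 qd.
have tail0 : 0 < tail n p D tc by exact: (tail_gt0 n p1 p2 D0 tc0).
have tail2' : tail n p D tc <= 2 * d.
  exact: le_of_scaled (ltW tail0) pow2_ge1 tail2.
have [hp hs] := HK t t0 Kt.
(* With T = t the decay bounds cover all times after [tc], so the local piece is empty and its
   pointwise constant can be 0. *)
have [||||||||SV SS] := @duhamel_step R n u p n0 mu_ cu p1 p2 t tc t D q
  ((t / 2) `^ (- beta) * q) (kappa n p l) 0 t0 tc1 (ltW t0) (lexx _) D0 q0.
- exact: mulr_ge0 (powR_ge0 _ _) q0.
- exact: kp0.
- exact: lexx.
- move=> s s0 st stc; have [_ _ /(_ (ltW rp))] := source_kappa p mu_ ul s0 st r1 rl rn.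
  move=> /le_trans; apply; rewrite lee_fin; apply: ge0_ler_powR.
  + exact: ltW.
  + by rewrite nnegrE; exact: mulr_ge0 (powR_ge0 _ _) k10.
  + by rewrite nnegrE.
  rewrite /q mulrC; apply: ler_wpM2l; first exact: k10.
  apply: ler_powRN2; [exact: ltW|exact: th0|].
  exact: sub_half_le t4 (ltW stc).
- move=> s x s0 sT stc st.
  have [_ /(_ x) /le_trans + _] := source_kappa p mu_ ul s0 st r1 rl rn.
  have -> : (t / 2) `^ (- beta) * q = (t / 2) `^ (- (n%:R / (2 * r))) * k1.
    rewrite exp_split opprD powRD; last by rewrite (gt_eqF th0) implybT.
    by rewrite /q [k1 * _]mulrC [LHS]mulrA.
  apply; rewrite lee_fin; apply: ler_wpM2r; first exact: k10.
  apply: ler_powRN2; [|exact: th0|].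
    by rewrite divr_ge0// mulr_ge0// ltW.
  apply: sub_half_le t4 _; apply: le_trans stc _.
  by rewrite ler_peMl ?ler1n// ltW.
- by move=> s s0 st; have [] := source_kappa p mu_ ul s0 st p1 pl pn.
- by move=> s x ts s0 st; move: st; rewrite ltNge ts.
- by move=> s tcs _; apply: uD; exact: lt_trans tcs.
have dd0 : 0 < 2 * d by exact: mulr_gt0.
have W0 : 0 < q * tc + kappa n p l * (t - t) + tail n p D tc.
  by rewrite subrr mulr0 addr0 ltr_wpDl.
have [c1 c2] := duhamel_combine t0 p1 mphi (mu_ t0) du pu dd0 W0 hp hs SV SS.
have e8 : e = 8 * d by rewrite /d mulrC divfK.
split.
  apply: le_trans c1 _; rewrite lee_fin; apply: ge0_ler_powR.
  - exact: ltW.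
  - by rewrite nnegrE; exact: addr_ge0 (ltW dd0) (ltW W0).
  - by rewrite nnegrE ltW.
  rewrite subrr mulr0 addr0 e8.
  exact: budget_five (ltW d0) qd' tail2'.
apply: filterS c2 => x /le_trans; apply.
rewrite mul0r addr0 (powR_half _ (ltW t0)) -/beta e8.
have -> : t `^ (- beta) * (2 * d) + (t `^ (- beta) * 2 `^ beta * q * tc +
    t `^ (- beta) * 2 `^ beta * tail n p D tc) =
  t `^ (- beta) * (2 * d + (2 `^ beta * (q * tc) + 2 `^ beta * tail n p D tc)).
  exact: budget_factor2.
rewrite [leRHS]mulrC; apply: ler_wpM2l; first exact: powR_ge0.
exact: budget_five (ltW d0) qd tail2.
Unshelve. all: by end_near. Qed.

End decay.

(** * Interpolation and smallness of the data *)

Section conclusion.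
Variables (R : realType) (n : nat).
Hypothesis n0 : (0 < n)%N.
Local Notation mu := (lebesgueRn R n).

Let n0R : (0 : R) < n%:R. Proof. by rewrite ltr0n. Qed.

(** |u|^q <= B^(q-p) |u|^p with B the sup bound; the exponent is n/(2p) times (q-p)/q. *)
Lemma Lp_norm_le_of_bounded (u : R -> Rn R n -> R) (p D t : R) (q : \bar R) :
  1 <= p -> 0 < D -> 0 < t -> measurable_fun setT (u t) ->
  bounded_at u p D t -> (p%:E <= q)%E ->
  (Lp_norm q (u t) <= (D * t `^ (- decay_exponent n p q))%:E)%E.
Proof.
move=> p1 D0 t0 mut [bp bi]; have p0 : 0 < p by rewrite (lt_le_trans _ p1).
rewrite /Lp_norm unlock /decay_exponent; case: q => [q| |//]; last first.
  move=> _; rewrite invey/= subr0.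
  have -> : n%:R / 2 * p^-1 = n%:R / (2 * p) by field; rewrite gt_eqF.
  (* The norm at [+oo] is defined by cases on the mass of the space, with value 0 in the degenerate
     one. *)
  case: ifPn => _; last by rewrite lee_fin mulr_ge0 ?powR_ge0// ltW.
  by apply/ess_supP; apply: filterS bi => x; rewrite /= lee_fin.
rewrite lee_fin => pq; have q0 : 0 < q by rewrite (lt_le_trans p0).
have qn0 : q != 0 by rewrite gt_eqF.
rewrite inver (negbTE qn0)/=.
pose B := D * t `^ (- (n%:R / (2 * p))).
have B0 : 0 < B by rewrite mulr_gt0// powR_gt0.
have I : (\int[mu]_x `|(EFin \o u t) x| `^ q <= ((B `^ (q - p) * D `^ p))%:E)%E.
  apply: (@le_trans _ _ (\int[mu]_x ((B `^ (q - p))%:E * (`|u t x| `^ p)%:E))%E).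
    apply: ae_ge0_le_integral => //.
    - by move=> x _; exact: poweR_ge0.
    - apply/measurable_EFinP; apply: measurable_fun_powR.
      exact: measurableT_comp.
    - by move=> x _; rewrite mule_ge0// lee_fin powR_ge0.
    - apply: measurable_funeM; apply/measurable_EFinP.
      by apply: measurable_fun_powR; exact: measurableT_comp.
    apply: filterS bi => x ux _; rewrite /= lee_fin.
    have -> : `|u t x| `^ q = `|u t x| `^ (q - p) * `|u t x| `^ p.
      by rewrite -powRD ?subrK// (negbTE qn0).
    rewrite ler_wpM2r ?powR_ge0//.
    by apply: ge0_ler_powR; rewrite ?nnegrE ?subr_ge0 ?(ltW B0).
  rewrite ge0_integralZl//; last 2 first.
  - apply/measurable_EFinP; apply: measurable_fun_powR.
    exact: measurableT_comp.
  - by rewrite lee_fin powR_ge0.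
  by rewrite EFinM lee_wpmul2l// lee_fin powR_ge0.
apply: (@le_trans _ _ (((B `^ (q - p) * D `^ p))%:E `^ q^-1)%E).
  apply: lee_poweR; [by rewrite invr_ge0 ltW| |exact: I].
  by apply: integral_ge0.
rewrite poweR_EFin lee_fin le_eqVlt; apply/orP; left; apply/eqP.
rewrite /B [(D * _) `^ _]powRM ?powR_ge0 ?(ltW D0)//.
rewrite mulrAC -powRD ?subrK; last by rewrite (gt_eqF D0) implybT.
rewrite powRM ?powR_ge0// -!powRrM divff// powRr1 ?(ltW D0)//.
by congr (_ * _ `^ _); field; rewrite qn0 gt_eqF.
Qed.

(** One factor M is kept for comparison with M itself; smallness of the datum acts through the
    surplus M^(4/n). *)
Lemma kappaE (r M : R) : 0 < M ->
  kappa n r (4 * M) = M * (M `^ (4 / n%:R) * kappa n r 4).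
Proof.
move=> M0; rewrite /kappa powRM ?(ltW M0)// [M `^ (1 + _)]powRD; last first.
  by rewrite (gt_eqF M0) implybT.
by rewrite powRr1 ?(ltW M0)//; ring.
Qed.

Lemma small_data (p b tc : R) : 1 <= p -> p < 2 -> 1 <= tc ->
  exists2 F, 0 < F & forall M, 0 < M -> M < F ->
    [/\ M <= 1, p * (4 * M) ^+ 2 <= 4^-1, n%:R * (4 * M) ^+ 2 <= 4^-1,
        2 `^ b * (kappa n p (4 * M) * (2 * tc)) <= M &
        2 * kappa n n%:R (4 * M) * (2 * tc) `^ 2^-1 * (2 * tc) `^ b <= M].
Proof.
move=> p1 p2 tc1.
have tc0 : 0 <= 2 * tc by rewrite mulr_ge0// (le_trans _ tc1).
pose c1 := 2 `^ b * (kappa n p 4 * (2 * tc)).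
pose c2 := 2 * kappa n n%:R 4 * (2 * tc) `^ 2^-1 * (2 * tc) `^ b.
have c10 : 0 <= c1.
  by apply: mulr_ge0; [exact: powR_ge0|exact: mulr_ge0 (kappa_ge0 _ _ _) tc0].
have c20 : 0 <= c2.
  apply: mulr_ge0; last exact: powR_ge0.
  apply: mulr_ge0; last exact: powR_ge0.
  by apply: mulr_ge0 => //; exact: kappa_ge0.
have C0 : 0 < 1 + c1 + c2 by rewrite -addrA ltr_wpDr// addr_ge0.
have n2 : (0 : R) < 64 * (n%:R + 2) by rewrite mulr_gt0// ltr_wpDl.
(* The bound 1/(64 (n+2)) yields 16 (n+2) M^2 <= M/4 <= 1/4, where n + 2 dominates both p and n. The
   last bound means M^(4/n) <= 1/(1 + c1 + c2). *)
exists (Num.min (Num.min 1 (64 * (n%:R + 2))^-1) ((1 + c1 + c2) `^ (- (n%:R / 4)))).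
  by rewrite !lt_min ltr01 invr_gt0 n2 powR_gt0.
move=> M M0; rewrite !lt_min => /andP[/andP[M1 Mn] MC].
have M2 a : 0 <= a -> a <= n%:R + 2 -> a * (4 * M) ^+ 2 <= 4^-1.
  move=> a0 an; have Mn' : 64 * (n%:R + 2) * M <= 1.
    by rewrite -ler_pdivlMl// mulr1 ltW.
  apply: (@le_trans _ _ ((n%:R + 2) * (4 * M) ^+ 2)).
    by rewrite ler_wpM2r// sqr_ge0.
  have -> : (n%:R + 2) * (4 * M) ^+ 2 = 64 * (n%:R + 2) * M * (M / 4) by field.
  apply: (@le_trans _ _ (1 * (M / 4))).
    by rewrite ler_wpM2r// divr_ge0// ltW.
  by rewrite mul1r ler_pdivrMr// mulVf// ltW.
have Mk c : 0 <= c -> c <= c1 + c2 -> M * (M `^ (4 / n%:R) * c) <= M.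
  move=> c0 cc; rewrite ler_piMr ?(ltW M0)//.
  have h : M `^ (4 / n%:R) <= (1 + c1 + c2)^-1.
    have -> : (1 + c1 + c2)^-1 = ((1 + c1 + c2) `^ (- (n%:R / 4))) `^ (4 / n%:R).
      rewrite -powRrM (_ : _ * _ = -1) ?powR_inv1 ?(ltW C0)//.
      by field; rewrite gt_eqF.
    by apply: ge0_ler_powR; rewrite ?nnegrE ?powR_ge0 ?divr_ge0 ?(ltW M0) ?(ltW MC).
  apply: (@le_trans _ _ ((1 + c1 + c2)^-1 * c)); first by rewrite ler_wpM2r.
  rewrite mulrC ler_pdivrMr// mul1r -addrA (le_trans cc)// lerDr//.
split.
- exact: ltW.
- apply: M2; first exact: le_trans p1.
  by rewrite ler_wpDl// ltW.
- by apply: M2; rewrite ?ler0n// lerDl.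
- rewrite kappaE//.
  have -> : 2 `^ b * (M * (M `^ (4 / n%:R) * kappa n p 4) * (2 * tc)) =
    M * (M `^ (4 / n%:R) * c1) by rewrite /c1; ring.
  by apply: Mk => //; rewrite lerDl.
- rewrite kappaE//.
  have -> : 2 * (M * (M `^ (4 / n%:R) * kappa n n%:R 4)) * (2 * tc) `^ 2^-1 *
    (2 * tc) `^ b = M * (M `^ (4 / n%:R) * c2) by rewrite /c2; ring.
  by apply: Mk => //; rewrite lerDr.
Qed.

End conclusion.

(** * The smallness threshold as a function of the exponent and the norm *)

Section smallness.
Variables (R : realType) (n : nat).
Hypothesis n0 : (0 < n)%N.
Local Notation mu := (lebesgueRn R n).

(* [tc] depends on [p] and [m] only; the threshold is then chosen after [tc]. *)
Lemma smallness_threshold : exists F : R -> R -> R, (forall p m, 0 < F p m) /\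
  forall p m, 1 <= p -> p < 2 -> 0 <= m -> exists tc, [/\ 1 <= tc,
    forall D, 0 < D -> D <= 4 * (1 + m) ->
      2 `^ (n%:R / (2 * p)) * tail n p D tc <= 4^-1 * D &
    forall M, 0 < M -> M < F p m -> [/\ M <= 1, p * (4 * M) ^+ 2 <= 4^-1,
      n%:R * (4 * M) ^+ 2 <= 4^-1,
      2 `^ (n%:R / (2 * p)) * (kappa n p (4 * M) * (2 * tc)) <= M &
      2 * kappa n n%:R (4 * M) * (2 * tc) `^ 2^-1 *
        (2 * tc) `^ (n%:R / (2 * p)) <= M]].
Proof.
(* The conditions on the pair are put inside [cond] so that choice applies to all pairs; outside the
   range the threshold is 1. *)
pose cond (pm : R * R) (F : R) := 0 < F /\ (1 <= pm.1 -> pm.1 < 2 -> 0 <= pm.2 ->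
  exists tc, [/\ 1 <= tc,
    forall D, 0 < D -> D <= 4 * (1 + pm.2) ->
      2 `^ (n%:R / (2 * pm.1)) * tail n pm.1 D tc <= 4^-1 * D &
    forall M, 0 < M -> M < F -> [/\ M <= 1, pm.1 * (4 * M) ^+ 2 <= 4^-1,
      n%:R * (4 * M) ^+ 2 <= 4^-1,
      2 `^ (n%:R / (2 * pm.1)) * (kappa n pm.1 (4 * M) * (2 * tc)) <= M &
      2 * kappa n n%:R (4 * M) * (2 * tc) `^ 2^-1 *
        (2 * tc) `^ (n%:R / (2 * pm.1)) <= M]]).
have /choice[F HF] : forall pm, exists F, cond pm F.
  move=> [p m]; have [[p1 p2 m0]|h] := pselect [/\ 1 <= p, p < 2 & 0 <= m].
    have D0 : 0 < 4 * (1 + m) by rewrite mulr_gt0// ltr_wpDr.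
    have q0 : (0 : R) < 4^-1 by rewrite invr_gt0.
    have [tc tc1 Htc] := tail_small n p1 p2 D0 q0.
    have [F F0 HF] := small_data n0 (n%:R / (2 * p)) p1 p2 tc1.
    by exists F; split => // _ _ _; exists tc.
  by exists 1; split => //= p1 p2 m0; exfalso; apply: h.
exists (fun p m => F (p, m)); split => [p m|p m]; by have [] := HF (p, m).
Qed.

Lemma expL2_norm_ge0 (v : Rn R n -> R) : (0 <= expL2_norm v)%E.
Proof.
by apply: le_ereal_inf_tmp => _ [l [l0 _] <-]; rewrite lee_fin ltW.
Qed.

Lemma critical_exponent_le (p : R) : 2 * n%:R / (n%:R + 4) <= p ->
  2 <= p * (1 + 4 / n%:R).
Proof.
have nR : (0 : R) < n%:R by rewrite ltr0n.
have n4 : (0 : R) < n%:R + 4 by rewrite addr_gt0.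
rewrite ler_pdivrMr// => h.
have -> : p * (1 + 4 / n%:R) = p * (n%:R + 4) / n%:R by field; rewrite gt_eqF.
by rewrite ler_pdivlMr.
Qed.

Lemma critical_exponent_lt2 : 2 * n%:R / (n%:R + 4) < 2 :> R.
Proof.
by rewrite ltr_pdivrMr ?ltr_wpDl// ltr_pM2l// ltrDl.
Qed.

Lemma integral_of_Lp_norm (phi : Rn R n -> R) (p m : R) : 0 < p ->
  Lp_norm p%:E phi = m%:E ->
  (\int[mu]_x (`|phi x| `^ p)%:E = (m `^ p)%:E)%E.
Proof.
by move=> p0 pm; rewrite -poweR_EFin -pm /Lp_norm poweR_Lnorm// gt_eqF.
Qed.

End smallness.

Theorem theorem2p2 (R : realType) (n : nat) (hn : (1 <= n)%N) :
  exists (eps C : R) (F : R -> R -> R),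
    [/\ 0 < eps, 0 < C, (forall r m : R, 0 < F r m) &
      forall (phi : Rn R n -> R) (u : R -> Rn R n -> R) (p : R),
        expL2 phi ->
        {ae lebesgueRn R n, forall x, 0 <= phi x} ->
        unique_small_positive_solution phi u ->
        1 <= p -> p < 2 ->
        phi \in Lfun (lebesgueRn R n) p%:E ->
        let p1 : R := Num.max 1 (2 * n%:R / (n%:R + 4)) in
        let ps : R := Num.max p (2 * n%:R / (n%:R + 4)) in
        (expL2_norm phi <
           (Num.min eps (F ps (fine (Lp_norm ps%:E phi))))%:E)%E ->
        (forall q : \bar R, (ps%:E <= q)%E ->
           forall t : R, 0 < t ->
             (Lp_norm q (u t) <=
               (C * t `^ (- decay_exponent n ps q))%:E *
               (expL2_norm phi + Lp_norm ps%:E phi))%E) /\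
        (p1 < p ->
           forall q : \bar R, (ps%:E <= q)%E ->
           forall e : R, 0 < e ->
             \forall t \near +oo,
               (Lp_norm q (u t) <=
                 (e * t `^ (- decay_exponent n ps q))%:E)%E)].
Proof.
have n0 : (0 < n)%N := hn.
have [F [F0 HF]] := smallness_threshold R n0.
(* C = 4 is the factor in the propagated bound 4 (M + m), with M decreasing to the exp L^2 norm; eps
   = 1 ensures M < 1, under which [tc] was chosen. *)
exists 1, 4, F; split => // phi u p ephi _ [[[eu _ cu du _] pu supu] _] p1 p2.
move=> phiL p1' ps phiF.
have mphi : measurable_fun setT phi by case: ephi.
have mu_ s : 0 < s -> measurable_fun setT (u s) by move=> /eu[].
have ps1 : 1 <= ps by rewrite /ps le_max p1.
have ps2 : ps < 2 by rewrite /ps gt_max p2 critical_exponent_lt2.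
have ps0 : 0 < ps by rewrite (lt_le_trans _ ps1).
have psn : 2 <= ps * (1 + 4 / n%:R).
  by apply: critical_exponent_le => //; rewrite /ps le_max lexx orbT.
have [M0 M0E] : exists M0, expL2_norm phi = M0%:E.
  exists (fine (expL2_norm phi)); rewrite fineK// ge0_fin_numE ?expL2_norm_ge0//.
  by rewrite (lt_trans phiF)// ltry.
have M00 : 0 <= M0 by rewrite -lee_fin -M0E expL2_norm_ge0.
have unorm s : 0 < s -> (expL2_norm (u s) <= (2 * M0)%:E)%E.
  move=> s0; rewrite EFinM -M0E; apply: le_trans supu.
  by apply: ereal_sup_ubound; exists s.
have N0 := Lnorm_ge0 (lebesgueRn R n) ps%:E (EFin \o phi).
(* An infinite norm makes the first claim trivial; in the second, ps = p, and phi in L^p excludes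
   it. *)
have [moo|mfin] := eqVneq (Lp_norm ps%:E phi) +oo%E.
  split.
    move=> q _ t t0; rewrite moo addey; last first.
      by rewrite gt_eqF// (lt_le_trans _ (expL2_norm_ge0 _))// ltNyr.
    by rewrite gt0_muley ?leey// lte_fin mulr_gt0 ?powR_gt0.
  move=> p1p; exfalso; have psp : ps = p.
    apply/max_idPl; apply: ltW; apply: le_lt_trans p1p.
    by rewrite /p1' le_max lexx orbT.
  move: phiL => /sub_Lfun_finLfun; rewrite inE /finite_norm => h.
  have : (Lp_norm ps%:E phi < +oo)%E by rewrite psp; exact: h.
  by rewrite moo ltxx.
have [m mE] : exists m, Lp_norm ps%:E phi = m%:E.
  by exists (fine (Lp_norm ps%:E phi)); rewrite fineK// ge0_fin_numE// ltey.
have m0 : 0 <= m by rewrite -lee_fin -mE.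
have phim := integral_of_Lp_norm ps0 mE.
pose X := Num.min 1 (F ps m).
have M0X : M0 < X by move: phiF; rewrite M0E mE /= lte_fin.
have [tc [tc1 Htail Hsmall]] := HF ps m ps1 ps2 m0.
(* The bound 2 M0 lies strictly below 4 M even when M0 = 0. *)
have ul M : M0 < M -> forall s, 0 < s -> (expL2_norm (u s) < (4 * M)%:E)%E.
  move=> MM s s0; apply: le_lt_trans (unorm s s0) _; rewrite lte_fin.
  by move: M00 MM; clear; lra.
have key M : M0 < M -> M < X -> forall t, 0 < t -> bounded_at u ps (4 * (M + m)) t.
  move=> M0M; rewrite lt_min => /andP[M1 MF] t t0.
  have Mgt0 : 0 < M by rewrite (le_lt_trans M00).
  have [_ pl nl kps kns] := Hsmall M Mgt0 MF.
  have MN : M <= M + m by rewrite lerDl.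
  apply: (@bootstrap R n phi u ps n0 mphi mu_ cu du pu ps1 ps2 psn (4 * M)
    (ul M M0M) M m tc) => //.
  - by rewrite phim.
  - have D0 : 0 < 4 * (M + m) by rewrite mulr_gt0// ltr_wpDr.
    have DD : 4 * (M + m) <= 4 * (1 + m) by rewrite ler_pM2l// lerD2r ltW.
    by have := Htail _ D0 DD; rewrite mulKf.
  - exact: le_trans kps MN.
  - exact: le_trans kns MN.
split.
  move=> q psq t t0; rewrite M0E mE -EFinD -EFinM.
  set c := t `^ _; have c0 : 0 < c by rewrite powR_gt0.
  apply/lee_addgt0Pr => e e0; rewrite -EFinD.
  (* M exceeds M0 so little that replacing it by M0 costs at most e after multiplication by 4 c. *)
  pose M := Num.min ((M0 + X) / 2) (M0 + e / (4 * c)).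
  have M0M : M0 < M.
    by rewrite lt_min !midf_lt//= ltrDl divr_gt0// mulr_gt0.
  have MX : M < X by rewrite gt_min !midf_lt.
  have Mgt0 : 0 < M by rewrite (le_lt_trans M00).
  have D0 : 0 < 4 * (M + m) by rewrite mulr_gt0// ltr_wpDr.
  apply: le_trans (Lp_norm_le_of_bounded ps1 D0 t0 (mu_ t t0) (key M M0M MX t t0) psq) _.
  rewrite lee_fin -/c.
  have Me : M <= M0 + e / (4 * c) by rewrite ge_min lexx orbT.
  have h : 4 * c * M <= 4 * c * (M0 + e / (4 * c)).
    by rewrite ler_wpM2l// mulr_ge0// ltW.
  have h2 : 4 * c * (e / (4 * c)) = e by rewrite mulrC divfK// gt_eqF ?mulr_gt0.
  rewrite mulrDr h2 in h.
  have -> : 4 * (M + m) * c = 4 * c * M + 4 * c * m by ring.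
  have -> : 4 * c * (M0 + m) + e = 4 * c * M0 + e + 4 * c * m by ring.
  by rewrite lerD2r.
move=> p1p q psq e e0.
pose M := (M0 + X) / 2.
have M0M : M0 < M by rewrite midf_lt.
have MX : M < X by rewrite midf_lt.
have Mgt0 : 0 < M by rewrite (le_lt_trans M00).
have D0 : 0 < 4 * (M + m) by rewrite mulr_gt0// ltr_wpDr.
have MF : M < F ps m by move: MX; rewrite lt_min => /andP[].
have [_ pl _ _ _] := Hsmall M Mgt0 MF.
have p1ps : p1' < ps by rewrite (lt_le_trans p1p)// /ps le_max lexx.
have p11 : 1 <= p1' by rewrite /p1' le_max lexx.
have p1n : 2 <= p1' * (1 + 4 / n%:R).
  by apply: critical_exponent_le => //; rewrite /p1' le_max lexx orbT.
have phifin : (\int[lebesgueRn R n]_x (`|phi x| `^ ps)%:E < +oo)%E.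
  by rewrite phim ltry.
(* The better exponent is r = p1', admissible by its definition; p1 < p makes it smaller than ps. *)
have dec := @decay_at_infinity R n phi u ps n0 mphi mu_ cu du pu ps1 ps2 (4 * M)
  (4 * (M + m)) p1' (ul M M0M) D0 (key M M0M MX) phifin p11 p1ps p1n pl e e0.
near=> t.
have t0 : 0 < t by near: t; apply: nbhs_pinfty_gt; exact: num_real.
apply: Lp_norm_le_of_bounded => //; first exact: mu_.
by near: t.
Unshelve. all: by end_near. Qed.
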